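(* Let $A$ be a uT-algebra which is weakly $\sigma^*$-compact-regular. Let $B$ be a locally convex algebra with jointly continuous multiplication, and let $\Phi: A\to B$ be an injective algebra homomorphism such that $C:=\overline{\operatorname{Im}\Phi}$ (closure in $B$, with the induced topology) is a Q-algebra. Then the following are equivalent: (1) $\Phi^{-1}|_{\operatorname{Im}\Phi}:\operatorname{Im}\Phi\to A$ is continuous, where $\operatorname{Im}\Phi$ carries the topology induced by $B$; (2) $\operatorname{Im}\Phi\cap SR(C)=\{0\}$; (3) the map $\Phi^{**}: M(C)\to M^*(A)$, $\Phi^{**}(f)=f\circ\Phi$, is surjective.
   Context: All algebras are complex, commutative and have a unit. A topological algebra is an algebra that is also a Hausdorff topological vector space in which multiplication is separately continuous; a locally convex algebra is a topological algebra whose topology is locally convex. A uniform seminorm on an algebra is a seminorm $p$ with $p(x^2)=p(x)^2$ for all $x$; a uT-algebra is a topological algebra whose topology is determined by a family of uniform seminorms. For an algebra $A$, $M^*(A)$ is the set of all nonzero multiplicative linear functionals on $A$ (with the weak* topology); for a topological algebra $A$, $M(A)$ is the set of nonzero continuous multiplicative linear functionals. A topological algebra is a Q-algebra if its set of invertible elements is open. A topological algebra $A$ is weakly $\sigma^*$-compact-regular if for every compact subset $K\subsetneq M^*(A)$ there is a nonzero $x\in A$ with $f(x)=0$ for all $f\in K$. For a topological algebra $C$ with $M(C)\neq\emptyset$, the strong radical is $SR(C)=\{x\in C : f(x)=0 \text{ for all } f\in M(C)\}$. *)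

(* Defs.v *)
From Stdlib Require Import Reals List.
Open Scope R_scope.

Record Cplx := mkC { Cre : R; Cim : R }.
Definition C0 : Cplx := mkC 0 0.
Definition C1 : Cplx := mkC 1 0.
Definition RtoC (r : R) : Cplx := mkC r 0.
Definition Cadd (z w : Cplx) : Cplx := mkC (Cre z + Cre w) (Cim z + Cim w).
Definition Copp (z : Cplx) : Cplx := mkC (- Cre z) (- Cim z).
Definition Cmul (z w : Cplx) : Cplx :=
  mkC (Cre z * Cre w - Cim z * Cim w) (Cre z * Cim w + Cim z * Cre w).
Definition Cnorm (z : Cplx) : R := sqrt (Cre z * Cre z + Cim z * Cim z).

Record CAlgebra := {
  car :> Type;
  a0 : car; a1 : car;
  aadd : car -> car -> car; aopp : car -> car;
  amul : car -> car -> car; asmul : Cplx -> car -> car;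
  addA : forall x y z, aadd x (aadd y z) = aadd (aadd x y) z;
  addC : forall x y, aadd x y = aadd y x;
  add0 : forall x, aadd a0 x = x;
  addN : forall x, aadd x (aopp x) = a0;
  smulA : forall a b x, asmul a (asmul b x) = asmul (Cmul a b) x;
  smul1 : forall x, asmul C1 x = x;
  smulDv : forall a x y, asmul a (aadd x y) = aadd (asmul a x) (asmul a y);
  smulDs : forall a b x, asmul (Cadd a b) x = aadd (asmul a x) (asmul b x);
  mulA : forall x y z, amul x (amul y z) = amul (amul x y) z;
  mulC : forall x y, amul x y = amul y x;
  mul1 : forall x, amul a1 x = x;
  mulDl : forall x y z, amul (aadd x y) z = aadd (amul x z) (amul y z);
  smul_mul : forall a x y, asmul a (amul x y) = amul (asmul a x) y
}.

Arguments a0 {c}. Arguments a1 {c}. Arguments aadd {c}. Arguments aopp {c}.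
Arguments amul {c}. Arguments asmul {c}.

Definition asub {A : CAlgebra} (x y : A) : A := aadd x (aopp y).

Definition is_topology {X : Type} (op : (X -> Prop) -> Prop) : Prop :=
  op (fun _ => True) /\
  (forall U V, op U -> op V -> op (fun x => U x /\ V x)) /\
  (forall F : (X -> Prop) -> Prop, (forall U, F U -> op U) ->
     op (fun x => exists U, F U /\ U x)).

Definition hausdorff {X : Type} (op : (X -> Prop) -> Prop) : Prop :=
  forall x y, x <> y -> exists U V, op U /\ op V /\ U x /\ V y /\
    forall z, ~ (U z /\ V z).

Definition jointly_continuous {X : Type} (op : (X -> Prop) -> Prop)
  (f : X -> X -> X) : Prop :=
  forall x y W, op W -> W (f x y) ->
    exists U V, op U /\ op V /\ U x /\ V y /\
      forall x' y', U x' -> V y' -> W (f x' y').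

Definition continuous_self {X : Type} (op : (X -> Prop) -> Prop)
  (g : X -> X) : Prop :=
  forall x W, op W -> W (g x) -> exists U, op U /\ U x /\ forall y, U y -> W (g y).

Definition smul_continuous (A : CAlgebra) (op : (A -> Prop) -> Prop) : Prop :=
  forall (l : Cplx) (x : A) W, op W -> W (asmul l x) ->
    exists eps U, eps > 0 /\ op U /\ U x /\
      forall mu y, Cnorm (Cadd mu (Copp l)) < eps -> U y -> W (asmul mu y).

Definition topological_algebra (A : CAlgebra) (op : (A -> Prop) -> Prop) : Prop :=
  is_topology op /\ hausdorff op /\
  jointly_continuous op (@aadd A) /\ smul_continuous A op /\
  (forall x : A, continuous_self op (fun y => amul x y)) /\
  (forall y : A, continuous_self op (fun x => amul x y)).

Definition convex {A : CAlgebra} (V : A -> Prop) : Prop :=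
  forall x y t, V x -> V y -> 0 <= t <= 1 ->
    V (aadd (asmul (RtoC t) x) (asmul (RtoC (1 - t)) y)).

Definition locally_convex_algebra (A : CAlgebra) (op : (A -> Prop) -> Prop) : Prop :=
  topological_algebra A op /\
  forall U x, op U -> U x ->
    exists V, op V /\ V x /\ convex V /\ forall y, V y -> U y.

Definition seminorm {A : CAlgebra} (p : A -> R) : Prop :=
  (forall x y, p (aadd x y) <= p x + p y) /\
  (forall a x, p (asmul a x) = Cnorm a * p x).

Definition uniform_seminorm {A : CAlgebra} (p : A -> R) : Prop :=
  seminorm p /\ forall x, p (amul x x) = p x * p x.

Definition seminorm_open {A : CAlgebra} {I : Type} (p : I -> A -> R)
  (U : A -> Prop) : Prop :=
  forall x, U x -> exists (l : list I) (eps : R), eps > 0 /\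
    forall y, (forall i, In i l -> p i (asub y x) < eps) -> U y.

Definition uT_algebra (A : CAlgebra) (op : (A -> Prop) -> Prop) : Prop :=
  topological_algebra A op /\
  exists (I : Type) (p : I -> A -> R),
    (forall i, uniform_seminorm (p i)) /\
    (forall U, op U <-> seminorm_open p U).

Definition is_char {A : CAlgebra} (f : A -> Cplx) : Prop :=
  (forall x y, f (aadd x y) = Cadd (f x) (f y)) /\
  (forall a x, f (asmul a x) = Cmul a (f x)) /\
  (forall x y, f (amul x y) = Cmul (f x) (f y)) /\
  (exists x, f x <> C0).

Definition wstar_open {A : CAlgebra} (S : (A -> Cplx) -> Prop) : Prop :=
  forall f, is_char f -> S f ->
    exists (l : list A) (eps : R), eps > 0 /\
      forall g, is_char g ->
        (forall x, In x l -> Cnorm (Cadd (g x) (Copp (f x))) < eps) -> S g.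

Definition wstar_compact {A : CAlgebra} (K : (A -> Cplx) -> Prop) : Prop :=
  (forall f, K f -> is_char f) /\
  forall (J : Type) (O : J -> (A -> Cplx) -> Prop),
    (forall j, wstar_open (O j)) ->
    (forall f, K f -> exists j, O j f) ->
    exists l : list J, forall f, K f -> exists j, In j l /\ O j f.

Definition weakly_sigma_star_compact_regular (A : CAlgebra) : Prop :=
  forall K : (A -> Cplx) -> Prop,
    wstar_compact K -> (exists g, is_char g /\ ~ K g) ->
    exists x : A, x <> a0 /\ forall f, K f -> f x = C0.

Definition alg_hom {A B : CAlgebra} (Phi : A -> B) : Prop :=
  (forall x y, Phi (aadd x y) = aadd (Phi x) (Phi y)) /\
  (forall a x, Phi (asmul a x) = asmul a (Phi x)) /\
  (forall x y, Phi (amul x y) = amul (Phi x) (Phi y)) /\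
  Phi a1 = a1.

Definition in_closure_im {A B : CAlgebra} (opB : (B -> Prop) -> Prop)
  (Phi : A -> B) (x : B) : Prop :=
  forall U, opB U -> U x -> exists a, U (Phi a).

Definition Q_algebra_closure {A B : CAlgebra} (opB : (B -> Prop) -> Prop)
  (Phi : A -> B) : Prop :=
  exists U, opB U /\ forall x, in_closure_im opB Phi x ->
    ((exists y, in_closure_im opB Phi y /\ amul x y = a1) <-> U x).

(* M(C): nonzero continuous multiplicative linear functionals on C
   (represented by functions on B, only their values on C matter) *)
Definition is_cont_char_C {A B : CAlgebra} (opB : (B -> Prop) -> Prop)
  (Phi : A -> B) (f : B -> Cplx) : Prop :=
  let C := in_closure_im opB Phi in
  (forall x y, C x -> C y -> f (aadd x y) = Cadd (f x) (f y)) /\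
  (forall a x, C x -> f (asmul a x) = Cmul a (f x)) /\
  (forall x y, C x -> C y -> f (amul x y) = Cmul (f x) (f y)) /\
  (exists x, C x /\ f x <> C0) /\
  (forall x eps, C x -> eps > 0 -> exists U, opB U /\ U x /\
     forall y, C y -> U y -> Cnorm (Cadd (f y) (Copp (f x))) < eps).

Definition strong_radical {A B : CAlgebra} (opB : (B -> Prop) -> Prop)
  (Phi : A -> B) (x : B) : Prop :=
  in_closure_im opB Phi x /\ forall f, is_cont_char_C opB Phi f -> f x = C0.

(* Main.v *)
(** The cycle is (1) => (2) => (3) => (1).

    A uniform seminorm [p] is submultiplicative, and for [p x > 0] there is a
    character [g] with [|g| <= p] and [|g x| = p x].  This is obtained without
    completions: replacing [p] by [z |-> lim p (z y^(2^n)) / p y ^ (2^n)] makes [y]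
    act multiplicatively, so a seminorm minimal among the uniform ones below [p]
    is multiplicative, and Ostrowski's argument shows that every element is a
    scalar modulo the kernel of a multiplicative seminorm.

    Under (1), such a [g] is bounded on a neighbourhood of [0] of [Im Phi] and
    extends to [C], so an element of the strong radical is killed by every [p].
    As [C] is a Q-algebra, its characters are bounded by [1] on one common
    neighbourhood [V] of [0]; their restrictions to [A] are exactly the characters
    bounded by [1] on [Phi^-1 V], and these form a compact set [K].  Under (2)
    regularity forces [K = M*(A)], which is (3); and under (3) every character of
    [A] is bounded on [Phi^-1 V], so every uniform seminorm is as well, giving (1). *)

From Stdlib Require Import Reals List Lra Lia Classical ClassicalEpsilon.
From mathcomp Require boolp classical_sets filter.
Require Import Defs.
Local Open Scope R_scope.

(** * Choice, Zorn's lemma and infima *)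

Lemma function_choice (X Y : Type) (R : X -> Y -> Prop) :
  (forall x, exists y, R x y) -> exists f, forall x, R x (f x).
Proof.
intros H.
exists (fun x => proj1_sig (constructive_indefinite_description _ (H x))).
intros x. exact (proj2_sig (constructive_indefinite_description _ (H x))).
Qed.

(** Transfers Zorn's lemma for boolean preorders to [Prop]-valued ones through [asbool]. *)
Lemma zorn_preorder (T : Type) (t0 : T) (le : T -> T -> Prop) :
  (forall t, le t t) -> (forall r s t, le r s -> le s t -> le r t) ->
  (forall S : T -> Prop, (forall s t, S s -> S t -> le s t \/ le t s) ->
     exists t, forall s, S s -> le s t) ->
  exists t, forall s, le t s -> le s t.
Proof.
intros Hr Ht Hc.
pose (R := fun s t => boolp.asbool (le s t)).
assert (RP : forall s t, is_true (R s t) <-> le s t).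
{ intros s t. unfold R. split; intros H.
  - exact (ssrbool.elimT (boolp.asboolP _) H).
  - exact (ssrbool.introT (boolp.asboolP _) H). }
destruct (@classical_sets.ZL_preorder T t0 R) as [t Hmax].
- intros t. apply RP, Hr.
- intros r s t H1 H2. apply RP. apply Ht with s; apply RP; assumption.
- intros S HS. destruct (Hc S) as [t Hub].
  + intros s t Hs Ht'. destruct (HS s t Hs Ht') as [H|H]; apply RP in H; tauto.
  + exists t. intros s Hs. apply RP, Hub, Hs.
- exists t. intros s H. apply RP, Hmax, RP, H.
Qed.

Lemma infimum_exists (E : R -> Prop) (b : R) :
  (exists r, E r) -> (forall r, E r -> b <= r) ->
  exists m, (forall r, E r -> m <= r) /\
    forall c, (forall r, E r -> c <= r) -> c <= m.
Proof.
intros [r0 H0] Hb.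
destruct (completeness (fun r => E (- r))) as [s [Hs1 Hs2]].
- exists (- b). intros r Hr. apply Hb in Hr. lra.
- exists (- r0). now rewrite Ropp_involutive.
- exists (- s). split.
  + intros r Hr. assert (- r <= s); [|lra].
    apply Hs1. now rewrite Ropp_involutive.
  + intros c Hc. assert (s <= - c); [|lra].
    apply Hs2. intros r Hr. apply Hc in Hr. lra.
Qed.

(** * Arithmetic and modulus of complex numbers *)

Lemma Cplx_ext z w : Cre z = Cre w -> Cim z = Cim w -> z = w.
Proof. destruct z, w; simpl; intros; subst; reflexivity. Qed.

Definition Csub z w := Cadd z (Copp w).

Lemma Cplx_ring : ring_theory C0 C1 Cadd Cmul Csub Copp eq.
Proof. split; intros; apply Cplx_ext; simpl; ring. Qed.
Add Ring Cplx_ring_tactic : Cplx_ring.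

Lemma Cnorm_ge0 z : 0 <= Cnorm z.
Proof. apply sqrt_pos. Qed.

Lemma Cnorm_sqr z : Cnorm z * Cnorm z = Cre z * Cre z + Cim z * Cim z.
Proof. apply sqrt_sqrt. nra. Qed.

Lemma Cnorm_mul z w : Cnorm (Cmul z w) = Cnorm z * Cnorm w.
Proof.
unfold Cnorm. rewrite <- sqrt_mult by nra. f_equal. simpl. ring.
Qed.

Lemma Cnorm_triangle z w : Cnorm (Cadd z w) <= Cnorm z + Cnorm w.
Proof.
pose proof (Cnorm_ge0 z). pose proof (Cnorm_ge0 w).
pose proof (Cnorm_sqr z) as Hz. pose proof (Cnorm_sqr w) as Hw.
pose proof (Cnorm_sqr (Cadd z w)) as Hzw. simpl in Hzw.
apply Rsqr_incr_0_var; [|lra]. unfold Rsqr. rewrite Hzw.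
assert (Cre z * Cre w + Cim z * Cim w <= Cnorm z * Cnorm w); [|nra].
apply Rsqr_incr_0_var; [|nra]. unfold Rsqr.
replace (Cnorm z * Cnorm w * (Cnorm z * Cnorm w))
  with ((Cnorm z * Cnorm z) * (Cnorm w * Cnorm w)) by ring.
rewrite Hz, Hw.
pose proof (Rle_0_sqr (Cre z * Cim w - Cim z * Cre w)). unfold Rsqr in *. nra.
Qed.

Lemma Cnorm_triangle3 u v w :
  Cnorm (Cadd u (Cadd v w)) <= Cnorm u + (Cnorm v + Cnorm w).
Proof.
pose proof (Cnorm_triangle u (Cadd v w)). pose proof (Cnorm_triangle v w). lra.
Qed.

Lemma Cnorm_real r : Cnorm (RtoC r) = Rabs r.
Proof.
unfold Cnorm, RtoC; simpl. rewrite <- sqrt_Rsqr_abs. unfold Rsqr. f_equal. ring.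
Qed.

Lemma Cnorm_C0 : Cnorm C0 = 0.
Proof. change C0 with (RtoC 0). rewrite Cnorm_real. apply Rabs_R0. Qed.

Lemma Cnorm_C1 : Cnorm C1 = 1.
Proof. change C1 with (RtoC 1). rewrite Cnorm_real. apply Rabs_R1. Qed.

Lemma Cnorm_opp z : Cnorm (Copp z) = Cnorm z.
Proof. unfold Cnorm; simpl. f_equal. ring. Qed.

Lemma Cnorm_sub_sym z w : Cnorm (Cadd z (Copp w)) = Cnorm (Cadd w (Copp z)).
Proof. rewrite <- Cnorm_opp. f_equal. ring. Qed.

Lemma Cnorm_sub_triangle u z w :
  Cnorm (Cadd z (Copp w)) <= Cnorm (Cadd z (Copp u)) + Cnorm (Cadd u (Copp w)).
Proof. rewrite <- Cnorm_triangle. right. f_equal. ring. Qed.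

Lemma Cnorm_eq0 z : Cnorm z = 0 -> z = C0.
Proof.
intros H. pose proof (Cnorm_sqr z) as Hz. rewrite H in Hz.
apply Cplx_ext; simpl; nra.
Qed.

Lemma Cnorm_pos z : z <> C0 -> 0 < Cnorm z.
Proof.
intros H. destruct (Cnorm_ge0 z) as [|H0]; [assumption|].
now contradiction H; apply Cnorm_eq0.
Qed.

Lemma Cnorm_re z : Rabs (Cre z) <= Cnorm z.
Proof.
pose proof (Cnorm_ge0 z). pose proof (Cnorm_sqr z).
apply Rabs_le. split; nra.
Qed.

Lemma Cnorm_im z : Rabs (Cim z) <= Cnorm z.
Proof.
pose proof (Cnorm_ge0 z). pose proof (Cnorm_sqr z).
apply Rabs_le. split; nra.
Qed.

Lemma Cnorm_le_re_im z : Cnorm z <= Rabs (Cre z) + Rabs (Cim z).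
Proof.
replace z with (Cadd (RtoC (Cre z)) (Cmul (mkC 0 1) (RtoC (Cim z)))) at 1
  by (apply Cplx_ext; simpl; ring).
rewrite Cnorm_triangle, Cnorm_mul, !Cnorm_real.
replace (Cnorm (mkC 0 1)) with 1; [lra|].
unfold Cnorm; simpl. replace (0 * 0 + 1 * 1) with 1 by ring. now rewrite sqrt_1.
Qed.

(** Half-angle formulas: the squares of the real and imaginary parts of the root are (|z| + Re z)/2
    and (|z| - Re z)/2, and the sign of Im z decides their relative sign. *)
Lemma Cplx_sqrt_exists z : exists w, Cmul w w = z.
Proof.
assert (Cre z <= Cnorm z /\ - Cnorm z <= Cre z) as [H1 H2].
{ pose proof (Cnorm_re z) as H. pose proof (Rle_abs (Cre z)).
  pose proof (Rle_abs (- Cre z)) as H'. rewrite Rabs_Ropp in H'. lra. }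
set (u := sqrt ((Cnorm z + Cre z) / 2)).
set (v := sqrt ((Cnorm z - Cre z) / 2)).
assert (Hu : u * u = (Cnorm z + Cre z) / 2) by (apply sqrt_sqrt; lra).
assert (Hv : v * v = (Cnorm z - Cre z) / 2) by (apply sqrt_sqrt; lra).
assert (Hu0 : 0 <= u) by apply sqrt_pos.
assert (Hv0 : 0 <= v) by apply sqrt_pos.
assert (Huv : (2 * (u * v)) * (2 * (u * v)) = Cim z * Cim z).
{ replace ((2 * (u * v)) * (2 * (u * v))) with (4 * ((u * u) * (v * v))) by ring.
  rewrite Hu, Hv. pose proof (Cnorm_sqr z). nra. }
destruct (Rle_or_lt 0 (Cim z)).
- assert (2 * (u * v) = Cim z) by (apply Rsqr_inj; unfold Rsqr; nra).
  exists (mkC u v). apply Cplx_ext; simpl; lra.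
- assert (2 * (u * v) = - Cim z) by (apply Rsqr_inj; unfold Rsqr; nra).
  exists (mkC u (- v)). apply Cplx_ext; simpl; lra.
Qed.

Lemma Cplx_inv_exists z : z <> C0 -> exists w, Cmul z w = C1.
Proof.
intros H. pose proof (Cnorm_pos z H). pose proof (Cnorm_sqr z) as Hz.
set (d := Cnorm z * Cnorm z) in *. assert (0 < d) by (unfold d; nra).
exists (mkC (Cre z / d) (- Cim z / d)).
apply Cplx_ext; simpl; [|field; lra].
replace (_ - _) with ((Cre z * Cre z + Cim z * Cim z) / d) by (field; lra).
rewrite <- Hz. field. lra.
Qed.

(** * Limits along Cauchy filter bases *)

Lemma real_cauchy_limit (T : Type) (F : (T -> Prop) -> Prop) (h : T -> R) :
  (forall U V, F U -> F V -> exists t, U t /\ V t) ->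
  (forall eps, eps > 0 -> exists U, F U /\
     forall s t, U s -> U t -> Rabs (h s - h t) < eps) ->
  exists L, forall eps, eps > 0 ->
    exists U, F U /\ forall t, U t -> Rabs (h t - L) < eps.
Proof.
intros Hmeet Hc.
(* The eventual lower bounds of [h]; their supremum, the lower limit, is the limit sought. *)
set (E := fun r => exists U, F U /\ forall t, U t -> r <= h t).
assert (Hub : forall eps U s, F U -> U s ->
  (forall s t, U s -> U t -> Rabs (h s - h t) < eps) -> is_upper_bound E (h s + eps)).
{ intros eps U s HU Hs HcU r [V [HV Hr]].
  destruct (Hmeet U V HU HV) as [t [Ht1 Ht2]].
  specialize (HcU t s Ht1 Hs). apply Rabs_def2 in HcU. specialize (Hr t Ht2). lra. }
destruct (completeness E) as [L [HL1 HL2]].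
- destruct (Hc 1 ltac:(lra)) as [U [HU HcU]].
  destruct (Hmeet U U HU HU) as [t [Ht _]].
  exists (h t + 1). now apply Hub with U.
- destruct (Hc 1 ltac:(lra)) as [U [HU HcU]].
  destruct (Hmeet U U HU HU) as [t [Ht _]].
  exists (h t - 1), U. split; [assumption|]. intros s Hs.
  specialize (HcU s t Hs Ht). apply Rabs_def2 in HcU. lra.
- exists L. intros eps Heps. destruct (Hc (eps / 2) ltac:(lra)) as [U [HU HcU]].
  exists U. split; [assumption|]. intros t Ht.
  assert (L <= h t + eps / 2) by (apply HL2, Hub with U; assumption).
  assert (h t - eps / 2 <= L).
  { apply HL1. exists U. split; [assumption|]. intros s Hs.
    specialize (HcU s t Hs Ht). apply Rabs_def2 in HcU. lra. }
  apply Rabs_def1; lra.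
Qed.

Lemma Cplx_cauchy_limit (T : Type) (F : (T -> Prop) -> Prop) (h : T -> Cplx) :
  (forall U V, F U -> F V -> exists W, F W /\ forall t, W t -> U t /\ V t) ->
  (forall U, F U -> exists t, U t) ->
  (forall eps, eps > 0 -> exists U, F U /\
     forall s t, U s -> U t -> Cnorm (Cadd (h s) (Copp (h t))) < eps) ->
  exists L, forall eps, eps > 0 ->
    exists U, F U /\ forall t, U t -> Cnorm (Cadd (h t) (Copp L)) < eps.
Proof.
intros HI Hne Hc.
assert (Hmeet : forall U V, F U -> F V -> exists t, U t /\ V t).
{ intros U V HU HV. destruct (HI U V HU HV) as [W [HW HWUV]].
  destruct (Hne W HW) as [t Ht]. exists t. now apply HWUV. }
destruct (real_cauchy_limit T F (fun t => Cre (h t)) Hmeet) as [x Hx].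
{ intros eps Heps. destruct (Hc eps Heps) as [U [HU HcU]].
  exists U. split; [assumption|]. intros s t Hs Ht.
  eapply Rle_lt_trans; [|apply (HcU s t Hs Ht)]. apply (Cnorm_re (Cadd (h s) (Copp (h t)))). }
destruct (real_cauchy_limit T F (fun t => Cim (h t)) Hmeet) as [y Hy].
{ intros eps Heps. destruct (Hc eps Heps) as [U [HU HcU]].
  exists U. split; [assumption|]. intros s t Hs Ht.
  eapply Rle_lt_trans; [|apply (HcU s t Hs Ht)]. apply (Cnorm_im (Cadd (h s) (Copp (h t)))). }
exists (mkC x y). intros eps Heps.
destruct (Hx (eps / 2) ltac:(lra)) as [U [HU HxU]].
destruct (Hy (eps / 2) ltac:(lra)) as [V [HV HyV]].
destruct (HI U V HU HV) as [W [HW HWUV]].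
exists W. split; [assumption|]. intros t Ht. destruct (HWUV t Ht) as [Ht1 Ht2].
eapply Rle_lt_trans; [apply Cnorm_le_re_im|]. simpl.
specialize (HxU t Ht1). specialize (HyV t Ht2). unfold Rminus in *. lra.
Qed.

(** * Ring structure, scalars and submultiplicativity of uniform seminorms *)

Lemma CAlgebra_ring (A : CAlgebra) :
  ring_theory (@a0 A) a1 aadd amul asub aopp eq.
Proof.
split; intros; try reflexivity.
- apply add0.
- apply addC.
- apply addA.
- apply mul1.
- apply mulC.
- apply mulA.
- apply mulDl.
- apply addN.
Qed.

Section UniformSeminorms.
Context {A : CAlgebra}.
Add Ring A_ring : (CAlgebra_ring A).

(** Turns scalar multiplication into ring multiplication, so that [ring] can prove identities that
    involve scalars. *)
Definition scalar (c : Cplx) : A := asmul c a1.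

Lemma asmul_scalar c (x : A) : asmul c x = amul (scalar c) x.
Proof. unfold scalar. rewrite <- smul_mul. f_equal. ring. Qed.

Lemma scalar_add c d : scalar (Cadd c d) = aadd (scalar c) (scalar d).
Proof. apply smulDs. Qed.

Lemma scalar_mul c d : scalar (Cmul c d) = amul (scalar c) (scalar d).
Proof. rewrite <- asmul_scalar. symmetry. apply smulA. Qed.

Lemma scalar_C1 : scalar C1 = a1.
Proof. apply smul1. Qed.

Lemma scalar_C0 : scalar C0 = a0.
Proof.
assert (H : aadd (scalar C0) (scalar C0) = scalar C0).
{ rewrite <- scalar_add. f_equal. ring. }
transitivity (asub (aadd (scalar C0) (scalar C0)) (scalar C0)); [ring|].
rewrite H. ring.
Qed.

Lemma scalar_opp c : scalar (Copp c) = aopp (scalar c).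
Proof.
transitivity (asub (aadd (scalar (Copp c)) (scalar c)) (scalar c)); [ring|].
rewrite <- scalar_add. replace (Cadd (Copp c) c) with C0 by ring.
rewrite scalar_C0. ring.
Qed.

Lemma seminorm_zero (p : A -> R) : seminorm p -> p a0 = 0.
Proof.
intros [_ H]. replace (@a0 A) with (asmul C0 (@a0 A)).
- rewrite H, Cnorm_C0. ring.
- rewrite asmul_scalar. ring.
Qed.

Lemma seminorm_opp (p : A -> R) x : seminorm p -> p (aopp x) = p x.
Proof.
intros [_ H]. replace (aopp x) with (asmul (Copp C1) x).
- rewrite H, Cnorm_opp, Cnorm_C1. ring.
- rewrite asmul_scalar, scalar_opp, scalar_C1. ring.
Qed.

Lemma seminorm_ge0 (p : A -> R) x : seminorm p -> 0 <= p x.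
Proof.
intros Hp. pose proof (proj1 Hp x (aopp x)) as H.
rewrite addN, seminorm_zero, seminorm_opp in H by assumption. lra.
Qed.

Lemma seminorm_sub (p : A -> R) x y : seminorm p -> p (asub x y) <= p x + p y.
Proof.
intros Hp. rewrite <- (seminorm_opp p y Hp). apply (proj1 Hp).
Qed.

(** The power x^(2^n); the defining identity of a uniform seminorm controls exactly these powers. *)
Fixpoint iter_sqr (n : nat) (x : A) : A :=
  match n with O => x | S n => amul (iter_sqr n x) (iter_sqr n x) end.

Lemma iter_sqr_mul n x y :
  iter_sqr n (amul x y) = amul (iter_sqr n x) (iter_sqr n y).
Proof. induction n as [|n IH]; simpl; [reflexivity|]. rewrite IH. ring. Qed.

Lemma pow_double (r : R) n : r ^ (2 ^ S n) = r ^ (2 ^ n) * r ^ (2 ^ n).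
Proof. rewrite <- pow_add. f_equal. simpl. lia. Qed.

Lemma uniform_iter_sqr (p : A -> R) n x :
  uniform_seminorm p -> p (iter_sqr n x) = p x ^ (2 ^ n).
Proof.
intros [_ Hu]. induction n as [|n IH].
- simpl. ring.
- rewrite pow_double. simpl. now rewrite Hu, IH.
Qed.

(** By Bernoulli's inequality and 2^n >= n, the powers of some r > 1 would grow at least
    linearly. *)
Lemma pow_bounded_le_1 (r K : R) :
  0 <= r -> (forall n, r ^ (2 ^ n) <= K) -> r <= 1.
Proof.
intros Hr H. apply Rnot_lt_le. intros Hr1.
assert (forall n, 1 + INR n * (r - 1) <= K) as Hlin.
{ intros n. specialize (H n).
  pose proof (poly (2 ^ n) (r - 1) ltac:(lra)) as Hb.
  replace (1 + (r - 1)) with r in Hb by ring.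
  assert (INR n <= INR (2 ^ n)).
  { apply le_INR. apply Nat.lt_le_incl, Nat.pow_gt_lin_r. lia. }
  nra. }
destruct (INR_unbounded ((K - 1) / (r - 1))) as [n Hn].
specialize (Hlin n).
assert (K - 1 < INR n * (r - 1)); [|lra].
apply Rmult_lt_compat_r with (r := r - 1) in Hn; [|lra].
replace ((K - 1) / (r - 1) * (r - 1)) with (K - 1) in Hn by (field; lra). lra.
Qed.

Lemma seminorm_real (p : A -> R) t x :
  seminorm p -> 0 <= t -> p (asmul (RtoC t) x) = t * p x.
Proof. intros [_ Hp] Ht. rewrite Hp, Cnorm_real, Rabs_pos_eq; auto. Qed.

(* Polarisation gives p(xy) <= 2 on the unit ball; taking 2^n-th powers removes
   the constant. *)
Lemma uniform_mul_le1 (p : A -> R) x y :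
  uniform_seminorm p -> p x <= 1 -> p y <= 1 -> p (amul x y) <= 1.
Proof.
intros Hu Hx Hy. pose proof (proj1 Hu) as Hp.
assert (H2 : forall x y, p x <= 1 -> p y <= 1 -> p (amul x y) <= 2).
{ clear x y Hx Hy. intros x y Hx Hy.
  pose proof (proj1 Hp x y). pose proof (seminorm_sub p x y Hp).
  pose proof (seminorm_ge0 p (aadd x y) Hp).
  pose proof (seminorm_ge0 p (asub x y) Hp).
  assert (H4 : p (asmul (RtoC 4) (amul x y)) <=
    p (amul (aadd x y) (aadd x y)) + p (amul (asub x y) (asub x y))).
  { rewrite <- seminorm_sub by assumption. right. f_equal.
    rewrite asmul_scalar.
    replace (RtoC 4) with (Cadd (Cadd C1 C1) (Cadd C1 C1))
      by (apply Cplx_ext; simpl; ring).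
    rewrite !scalar_add, scalar_C1. ring. }
  rewrite seminorm_real, !(proj2 Hu) in H4 by (assumption || lra). nra. }
apply pow_bounded_le_1 with 2; [now apply seminorm_ge0|].
intros n. rewrite <- uniform_iter_sqr by assumption. rewrite iter_sqr_mul.
assert (forall z, p z <= 1 -> p (iter_sqr n z) <= 1) as Hn.
{ intros z Hz. rewrite uniform_iter_sqr, <- (pow1 (2 ^ n)) by assumption.
  apply pow_incr. split; [now apply seminorm_ge0|assumption]. }
apply H2; now apply Hn.
Qed.

(** Homogeneity reduces to the unit ball: x/s and y/t lie in it for all s > p x and t > p y. The
    strict inequalities allow for [p x] or [p y] being zero; then s and t decrease to these
    values. *)
Lemma uniform_submul (p : A -> R) x y :
  uniform_seminorm p -> p (amul x y) <= p x * p y.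
Proof.
intros Hu. pose proof (proj1 Hu) as Hp.
assert (H : forall s t, p x < s -> p y < t -> p (amul x y) <= s * t).
{ intros s t Hs Ht.
  pose proof (seminorm_ge0 p x Hp). pose proof (seminorm_ge0 p y Hp).
  assert (0 < / s) by (apply Rinv_0_lt_compat; lra).
  assert (0 < / t) by (apply Rinv_0_lt_compat; lra).
  assert (Hst : p (amul (asmul (RtoC (/ s)) x) (asmul (RtoC (/ t)) y)) <= 1).
  { apply uniform_mul_le1; [assumption| |];
    rewrite seminorm_real by (assumption || lra).
    - apply Rmult_le_reg_l with s; [lra|]. rewrite <- Rmult_assoc, Rinv_r by lra. lra.
    - apply Rmult_le_reg_l with t; [lra|]. rewrite <- Rmult_assoc, Rinv_r by lra. lra. }
  replace (amul _ _) with (asmul (RtoC (/ s)) (asmul (RtoC (/ t)) (amul x y))) in Hst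
    by (rewrite !asmul_scalar; ring).
  rewrite !seminorm_real in Hst by (assumption || lra).
  apply Rmult_le_compat_l with (r := s * t) in Hst; [|nra].
  replace (s * t * (/ s * (/ t * p (amul x y)))) with (p (amul x y)) in Hst
    by (field; lra). lra. }
apply le_epsilon. intros e He.
pose proof (seminorm_ge0 p x Hp). pose proof (seminorm_ge0 p y Hp).
(* Since d <= 1, (p x + d)(p y + d) exceeds p x p y by at most d (p x + p y + 1) <= e. *)
set (d := Rmin 1 (e / (p x + p y + 1))).
assert (Hd : 0 < d) by (apply Rmin_pos; [lra|apply Rdiv_lt_0_compat; lra]).
assert (Hd1 : d <= 1) by apply Rmin_l.
assert (Hd2 : d * (p x + p y + 1) <= e).
{ apply Rle_trans with (e / (p x + p y + 1) * (p x + p y + 1)); [|right; field; lra].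
  apply Rmult_le_compat_r; [lra|apply Rmin_r]. }
specialize (H (p x + d) (p y + d) ltac:(lra) ltac:(lra)). nra.
Qed.

(** * Minimal uniform seminorms *)

(** The pointwise infimum works: directedness yields the triangle inequality, and the two squaring
    conditions yield the two halves of q(z^2) = q(z)^2. It serves both for the decreasing sequence
    of a localization and for the chains in Zorn's lemma. *)
Lemma infimum_uniform_seminorm (I : Type) (v : I -> A -> R) (i0 : I) :
  (forall i, seminorm (v i)) ->
  (forall i j, exists k, forall z, v k z <= v i z /\ v k z <= v j z) ->
  (forall i, exists j, forall z, v j (amul z z) <= v i z * v i z) ->
  (forall i, exists j, forall z, v j z * v j z <= v i (amul z z)) ->
  exists q, uniform_seminorm q /\ (forall i z, q z <= v i z) /\
    forall z b, (forall i, b <= v i z) -> b <= q z.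
Proof.
intros Hv Hdir Hsq1 Hsq2.
destruct (function_choice A R (fun z m => (forall i, m <= v i z) /\
  forall b, (forall i, b <= v i z) -> b <= m)) as [q Hq].
{ intros z. destruct (infimum_exists (fun r => exists i, r = v i z) 0) as [m [H1 H2]].
  - now exists (v i0 z), i0.
  - intros r [i ->]. now apply seminorm_ge0.
  - exists m. split.
    + intros i. apply H1. now exists i.
    + intros b Hb. apply H2. intros r [i ->]. apply Hb. }
assert (Hle : forall i z, q z <= v i z) by (intros; apply Hq).
assert (Hglb : forall z b, (forall i, b <= v i z) -> b <= q z) by (intros; now apply Hq).
clear Hq.
assert (Hq0 : forall z, 0 <= q z).
{ intros z. apply Hglb. intros i. now apply seminorm_ge0. }
exists q. split; [|tauto]. split; [split|].
- intros x y.
  (* The infimum is taken over one summand at a time, with a common index [k] below both [i] and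
     [j]. *)
  assert (q (aadd x y) - q y <= q x); [|lra].
  apply Hglb. intros i.
  assert (q (aadd x y) - v i x <= q y); [|lra].
  apply Hglb. intros j. destruct (Hdir i j) as [k Hk].
  pose proof (Hle k (aadd x y)). pose proof (proj1 (Hv k) x y).
  pose proof (Hk x). pose proof (Hk y). lra.
- intros c x. apply Rle_antisym.
  + destruct (classic (c = C0)) as [->|Hc].
    * rewrite Cnorm_C0, Rmult_0_l.
      apply Rle_trans with (v i0 (asmul C0 x)); [apply Hle|].
      rewrite (proj2 (Hv i0)), Cnorm_C0. lra.
    * apply Cnorm_pos in Hc.
      assert (q (asmul c x) / Cnorm c <= q x) as H.
      { apply Hglb. intros i. apply Rmult_le_reg_r with (Cnorm c); [assumption|].
        replace (q (asmul c x) / Cnorm c * Cnorm c) with (q (asmul c x)) by (field; lra).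
        rewrite Rmult_comm, <- (proj2 (Hv i)). apply Hle. }
      apply Rmult_le_compat_l with (r := Cnorm c) in H; [|lra].
      replace (Cnorm c * (q (asmul c x) / Cnorm c)) with (q (asmul c x)) in H
        by (field; lra). assumption.
  + apply Hglb. intros i. rewrite (proj2 (Hv i)).
    apply Rmult_le_compat_l; [apply Cnorm_ge0|apply Hle].
- intros x. apply Rle_antisym.
  + assert (Hs : sqrt (q (amul x x)) <= q x).
    { apply Hglb. intros i. destruct (Hsq1 i) as [j Hj].
      apply Rsqr_incr_0_var; [|now apply seminorm_ge0].
      unfold Rsqr. rewrite sqrt_sqrt by apply Hq0.
      apply Rle_trans with (v j (amul x x)); [apply Hle|apply Hj]. }
    rewrite <- (sqrt_sqrt (q (amul x x))) by apply Hq0.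
    pose proof (sqrt_pos (q (amul x x))). pose proof (Hq0 x). nra.
  + apply Hglb. intros i. destruct (Hsq2 i) as [j Hj].
    eapply Rle_trans; [|apply Hj].
    pose proof (Hle j x). pose proof (Hq0 x). nra.
Qed.

(** For a uniform [q] with q x <= 1 this says that multiplication by [x] preserves [q]. As an
    inequality valid for all [z], it passes to infima. *)
Definition expanding (q : A -> R) (x : A) : Prop := forall z, q z <= q (amul x z).

(* Take q z = lim p (z y^(2^n)). *)
Lemma uniform_localization (p : A -> R) (y : A) :
  uniform_seminorm p -> p y = 1 ->
  exists q, uniform_seminorm q /\ (forall z, q z <= p z) /\ 1 <= q a1 /\
    expanding q y /\ forall x, expanding p x -> expanding q x.
Proof.
intros Hu Hy. pose proof (proj1 Hu) as Hp.
assert (Hs : forall n, p (iter_sqr n y) = 1).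
{ intros n. now rewrite uniform_iter_sqr, Hy, pow1. }
pose (v := fun n z => p (amul z (iter_sqr n y))).
assert (Hv1 : forall n z, v (S n) z <= v n z).
{ intros n z. unfold v. simpl.
  replace (amul z (amul (iter_sqr n y) (iter_sqr n y)))
    with (amul (amul z (iter_sqr n y)) (iter_sqr n y)) by ring.
  rewrite uniform_submul, Hs by assumption. lra. }
assert (Hanti : forall m n z, (m <= n)%nat -> v n z <= v m z).
{ intros m n z Hmn. induction Hmn; [lra|].
  eapply Rle_trans; [apply Hv1|assumption]. }
assert (Hv2 : forall n z, v (S n) (amul z z) = v n z * v n z).
{ intros n z. unfold v. rewrite <- (proj2 Hu). f_equal. simpl. ring. }
destruct (infimum_uniform_seminorm nat v O) as [q [Hqu [Hle Hglb]]].
- intros n. split.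
  + intros x z. unfold v. rewrite mulDl. apply (proj1 Hp).
  + intros c x. unfold v. rewrite <- smul_mul. apply (proj2 Hp).
- intros m n. exists (Nat.max m n). intros z. split; apply Hanti; lia.
- intros n. exists (S n). intros z. rewrite Hv2. lra.
- intros n. exists n. intros z. rewrite <- Hv2. apply Hv1.
- exists q. split; [assumption|]. split; [|split; [|split]].
  + intros z. apply Rle_trans with (v O z); [apply Hle|].
    unfold v. simpl. rewrite uniform_submul, Hy by assumption. lra.
  + apply Hglb. intros n. unfold v. rewrite mul1, Hs. lra.
  + intros z. apply Hglb. intros n. apply Rle_trans with (v (S n) z); [apply Hle|].
    (* Splitting one factor [y] off y^(2^n) leaves a cofactor of seminorm at most 1, so v (S n) z <=
       v n (y z); the infimum over [n] makes [y] expanding. *)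
    assert (exists w, iter_sqr n y = amul y w /\ p w <= 1) as [w [Hw Hw1]].
    { clear - Hu Hs Hy. induction n as [|n [w [Hw Hw1]]].
      - exists a1. split; [simpl; ring|].
        pose proof (uniform_submul p a1 a1 Hu) as H.
        pose proof (proj2 Hu a1) as H1. rewrite mul1 in H1. nra.
      - exists (amul w (iter_sqr n y)). split.
        + simpl. rewrite Hw at 1. ring.
        + rewrite uniform_submul, Hs by assumption. lra. }
    unfold v. simpl.
    replace (amul z (amul (iter_sqr n y) (iter_sqr n y)))
      with (amul (amul (amul y z) (iter_sqr n y)) w) by (rewrite Hw; ring).
    rewrite uniform_submul by assumption.
    pose proof (seminorm_ge0 p (amul (amul y z) (iter_sqr n y)) Hp). nra.
  + intros x Hx z. apply Hglb. intros n. apply Rle_trans with (v n z); [apply Hle|].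
    unfold v. rewrite <- mulA. apply Hx.
Qed.

(** Localizing a minimal [q] at any [y] with q y = 1 yields a seminorm below [q], hence no smaller
    than [q]; so [y] was already expanding for [q]. *)
Lemma minimal_uniform_seminorm (p : A -> R) (x : A) :
  uniform_seminorm p -> p x = 1 ->
  exists q, uniform_seminorm q /\ (forall z, q z <= p z) /\ 1 <= q a1 /\
    expanding q x /\ forall y, q y = 1 -> expanding q y.
Proof.
intros Hu Hx.
(* The bound 1 <= q a1 keeps infima of chains nonzero, and expansion by [x] keeps the value at [x]
   from dropping below it. *)
pose (good := fun q : A -> R => uniform_seminorm q /\ (forall z, q z <= p z) /\
  1 <= q a1 /\ expanding q x).
destruct (uniform_localization p x Hu Hx) as [q0 [H1 [H2 [H3 [H4 _]]]]].
assert (Hq0 : good q0) by (unfold good; tauto). clear H1 H2 H3 H4.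
(* The order is reversed, so a maximal element is a minimal seminorm. *)
pose (le := fun s t : {q | good q} => forall z, proj1_sig t z <= proj1_sig s z).
destruct (zorn_preorder {q | good q} (exist _ q0 Hq0) le) as [[q Hq] Hmin].
- intros t z. lra.
- intros r s t Hrs Hst z. specialize (Hrs z). specialize (Hst z). lra.
- intros S Hchain.
  destruct (classic (exists s, S s)) as [[s0 Hs0]|Hempty].
  2:{ exists (exist _ q0 Hq0). intros s Hs. contradiction Hempty. now exists s. }
  destruct (infimum_uniform_seminorm {s | S s} (fun i => proj1_sig (proj1_sig i))
    (exist _ s0 Hs0)) as [q [Hqu [Hle Hglb]]].
  + intros [[q Hq] Hs]. apply Hq.
  + intros [s Hs] [t Ht]. destruct (Hchain s t Hs Ht) as [H|H].
    * exists (exist _ t Ht). intros z. specialize (H z). simpl. lra.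
    * exists (exist _ s Hs). intros z. specialize (H z). simpl. lra.
  + intros [[q Hq] Hs]. exists (exist _ (exist _ q Hq) Hs). intros z. simpl.
    right. apply Hq.
  + intros [[q Hq] Hs]. exists (exist _ (exist _ q Hq) Hs). intros z. simpl.
    right. symmetry. apply Hq.
  + assert (Hq : good q).
    { split; [assumption|]. split; [|split].
      - intros z. eapply Rle_trans; [apply (Hle (exist _ s0 Hs0))|].
        apply (proj2_sig s0).
      - apply Hglb. intros [[q' Hq'] Hs]. apply Hq'.
      - intros z. apply Hglb. intros i. eapply Rle_trans; [apply (Hle i)|].
        destruct i as [[q' Hq'] Hs]. apply Hq'. }
    exists (exist _ q Hq). intros s Hs z. apply (Hle (exist _ s Hs)).
- exists q. destruct Hq as [Hqu [Hqp [Hq1 Hqx]]].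
  repeat (split; [assumption|]).
  intros y Hy. destruct (uniform_localization q y Hqu Hy) as [q' [H1 [H2 [H3 [H4 H5]]]]].
  assert (Hq' : good q').
  { split; [assumption|]. split; [|split; [assumption|now apply H5]].
    intros z. eapply Rle_trans; [apply H2|apply Hqp]. }
  intros z. eapply Rle_trans; [apply (Hmin (exist _ q' Hq') H2)|].
  simpl. eapply Rle_trans; [apply H4|apply H2].
Qed.

Definition multiplicative (q : A -> R) : Prop :=
  seminorm q /\ q a1 = 1 /\ forall x y, q (amul x y) = q x * q y.

(** For a minimal [q], every y / q y with q y > 0 is expanding, which is the converse of
    submultiplicativity; if q y = 0 both sides vanish. *)
Lemma uniform_dominates_multiplicative (p : A -> R) (x : A) :
  uniform_seminorm p -> p x = 1 ->
  exists q, multiplicative q /\ (forall z, q z <= p z) /\ q x = 1.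
Proof.
intros Hu Hx.
destruct (minimal_uniform_seminorm p x Hu Hx) as [q [Hqu [Hqp [Hq1 [Hqx Hmin]]]]].
pose proof (proj1 Hqu) as Hq.
assert (H1 : q a1 = 1).
{ pose proof (proj2 Hqu a1) as H. rewrite mul1 in H. nra. }
exists q. split; [split; [assumption|split; [assumption|]]|split; [assumption|]].
- intros y z. apply Rle_antisym; [now apply uniform_submul|].
  destruct (seminorm_ge0 q y Hq) as [Hy|Hy].
  2:{ rewrite <- Hy, Rmult_0_l. now apply seminorm_ge0. }
  assert (0 < / q y) by now apply Rinv_0_lt_compat.
  assert (Hexp : expanding q (asmul (RtoC (/ q y)) y)).
  { apply Hmin. rewrite seminorm_real by (assumption || lra). field. lra. }
  specialize (Hexp z). rewrite <- smul_mul, seminorm_real in Hexp by (assumption || lra).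
  apply Rmult_le_compat_l with (r := q y) in Hexp; [|lra].
  rewrite <- Rmult_assoc, Rinv_r in Hexp by lra. lra.
- apply Rle_antisym; [rewrite <- Hx; apply Hqp|].
  specialize (Hqx a1). replace (amul x a1) with x in Hqx by ring. lra.
Qed.

(** * Ostrowski's argument and characters from multiplicative seminorms *)

Lemma pow_near_1 (n : nat) (d : R) :
  0 < d -> exists d', 0 < d' /\ (1 + d') ^ n <= 1 + d.
Proof.
revert d. induction n as [|n IH]; intros d Hd.
- exists 1. simpl. lra.
- destruct (IH (d / 2) ltac:(lra)) as [d1 [Hd1 Hpow]].
  (* The second bound is what (1 + e)(1 + d/2) <= 1 + d requires. *)
  set (e := Rmin d1 (d / (2 + d))).
  assert (0 < e) by (apply Rmin_pos; [|apply Rdiv_lt_0_compat]; lra).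
  assert (e <= d1) by apply Rmin_l.
  assert (e * (2 + d) <= d).
  { apply Rle_trans with (d / (2 + d) * (2 + d)); [|right; field; lra].
    apply Rmult_le_compat_r; [lra|apply Rmin_r]. }
  exists e. split; [assumption|]. simpl.
  assert ((1 + e) ^ n <= (1 + d1) ^ n) by (apply pow_incr; lra).
  nra.
Qed.

Lemma scalar_norm (q : A -> R) c : multiplicative q -> q (scalar c) = Cnorm c.
Proof. intros [[_ Hq] [H1 _]]. unfold scalar. rewrite Hq, H1. ring. Qed.

Lemma multiplicative_uniform (q : A -> R) : multiplicative q -> uniform_seminorm q.
Proof. intros [Hq [_ HM]]. split; [assumption|]. intros x. apply HM. Qed.

(** With d = e^2, the difference of squares splits into the factors b^(2^n) - e and b^(2^n) + e,
    each of value at least 1 by induction. *)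
Lemma dist_iter_sqr_ge_1 (q : A -> R) (a : A) :
  multiplicative q -> (forall c, 1 <= q (asub a (scalar c))) ->
  forall n c d, 1 <= q (asub (iter_sqr n (asub a (scalar c))) (scalar d)).
Proof.
intros Hq Ha n c. induction n as [|n IH]; intros d.
- simpl. replace (asub _ _) with (asub a (scalar (Cadd c d))); [apply Ha|].
  rewrite scalar_add. ring.
- destruct (Cplx_sqrt_exists d) as [e <-]. simpl.
  replace (asub _ _) with (amul
    (asub (iter_sqr n (asub a (scalar c))) (scalar e))
    (asub (iter_sqr n (asub a (scalar c))) (scalar (Copp e))))
    by (rewrite scalar_mul, scalar_opp; ring).
  rewrite (proj2 (proj2 Hq)). pose proof (IH e). pose proof (IH (Copp e)). nra.
Qed.

(* b - w divides b^(2^n) - w^(2^n), with a cofactor on which q is at least 1. *)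
Lemma dist_shift_le (q : A -> R) (a : A) :
  multiplicative q -> (forall c, 1 <= q (asub a (scalar c))) ->
  forall n c w, q (asub (asub a (scalar c)) (scalar w)) <=
    q (asub a (scalar c)) ^ (2 ^ n) + Cnorm w ^ (2 ^ n).
Proof.
intros Hq Ha n c w. set (b := asub a (scalar c)).
(* The witness is w^(2^n), of which only the modulus matters afterwards. *)
assert (exists d, Cnorm d = Cnorm w ^ (2 ^ n) /\
  q (asub b (scalar w)) <= q (asub (iter_sqr n b) (scalar d))) as [d [Hd Hle]].
{ induction n as [|n [d [Hd Hle]]].
  - exists w. simpl. split; [ring|lra].
  - exists (Cmul d d). split; [rewrite Cnorm_mul, Hd; symmetry; apply pow_double|].
    simpl. replace (asub (amul _ _) _) with (amul (asub (iter_sqr n b) (scalar d))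
      (asub (iter_sqr n b) (scalar (Copp d))))
      by (rewrite scalar_mul, scalar_opp; ring).
    rewrite (proj2 (proj2 Hq)).
    pose proof (dist_iter_sqr_ge_1 q a Hq Ha n c (Copp d)) as H. fold b in H.
    pose proof (seminorm_ge0 q (asub (iter_sqr n b) (scalar d)) (proj1 Hq)). nra. }
eapply Rle_trans; [apply Hle|].
rewrite <- Hd, <- (scalar_norm q d Hq), <- uniform_iter_sqr
  by now apply multiplicative_uniform.
apply seminorm_sub, Hq.
Qed.

(* Ostrowski: near the minimum of c |-> q (a - c) the function cannot grow,
   so translating c repeatedly by 1/2 keeps it near the minimum. *)
Lemma dist_to_scalars_not_1 (q : A -> R) (a : A) :
  multiplicative q -> (forall c, 1 <= q (asub a (scalar c))) ->
  (forall d, 0 < d -> exists c, q (asub a (scalar c)) <= 1 + d) -> False.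
Proof.
intros Hq Ha Hinf.
assert (Hstep : forall d, 0 < d -> exists d', 0 < d' /\
  forall c, q (asub a (scalar c)) <= 1 + d' ->
    q (asub a (scalar (Cadd c (RtoC (/ 2))))) <= 1 + d).
{ intros d Hd.
  (* First [N] makes (1/2)^(2^N) < d/2, then d' makes (1 + d')^(2^N) <= 1 + d/2; the two add up to
     at most 1 + d. *)
  destruct (pow_lt_1_zero (/ 2) ltac:(rewrite Rabs_pos_eq; lra) (d / 2) ltac:(lra))
    as [N HN].
  specialize (HN (2 ^ N)%nat ltac:(apply Nat.lt_le_incl, Nat.pow_gt_lin_r; lia)).
  apply Rabs_def2 in HN.
  destruct (pow_near_1 (2 ^ N) (d / 2) ltac:(lra)) as [d' [Hd' Hpow]].
  exists d'. split; [assumption|]. intros c Hc.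
  pose proof (dist_shift_le q a Hq Ha N c (RtoC (/ 2))) as H.
  rewrite Cnorm_real, Rabs_pos_eq in H by lra.
  replace (asub a _) with (asub (asub a (scalar c)) (scalar (RtoC (/ 2))))
    by (rewrite scalar_add; ring).
  assert (q (asub a (scalar c)) ^ (2 ^ N) <= (1 + d') ^ (2 ^ N)); [|lra].
  apply pow_incr. split; [apply seminorm_ge0, Hq|assumption]. }
assert (Hk : forall k d, 0 < d -> exists c, q (asub a (scalar c)) <= 1 + d /\
  q (asub a (scalar (Cadd c (RtoC (INR k / 2))))) <= 1 + d).
{ induction k as [|k IH]; intros d Hd.
  - destruct (Hinf d Hd) as [c Hc]. exists c. split; [assumption|].
    replace (Cadd c _) with c by (apply Cplx_ext; simpl; lra). assumption.
  - destruct (Hstep d Hd) as [d' [Hd' Hs]].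
    destruct (IH (Rmin d d') ltac:(now apply Rmin_pos)) as [c [Hc1 Hc2]].
    pose proof (Rmin_l d d'). pose proof (Rmin_r d d').
    exists c. split; [lra|].
    replace (Cadd c _) with (Cadd (Cadd c (RtoC (INR k / 2))) (RtoC (/ 2)))
      by (rewrite S_INR; apply Cplx_ext; simpl; lra).
    apply Hs. lra. }
(* Ten half steps shift [c] by 5, while both ends have value at most 2, so the triangle inequality
   would give 5 <= 4. *)
destruct (Hk 10%nat 1 ltac:(lra)) as [c [Hc1 Hc2]].
replace (INR 10 / 2) with 5 in Hc2 by (simpl; lra).
pose proof (seminorm_sub q _ _ (proj1 Hq) : q (asub (asub a (scalar c))
  (asub a (scalar (Cadd c (RtoC 5))))) <= _) as H.
replace (asub (asub _ _) _) with (scalar (RtoC 5)) in H by (rewrite scalar_add; ring).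
rewrite (scalar_norm q _ Hq), Cnorm_real, Rabs_pos_eq in H by lra. lra.
Qed.

(** Let [m] be the infimum of q (a - c). If m > 0, dividing [a] by [m] contradicts Ostrowski's
    argument. If m = 0, near-minimizing scalars are Cauchy because |s - t| <= q (a - s) + q (a - t),
    and their limit attains 0. *)
Lemma multiplicative_scalar_part (q : A -> R) (a : A) :
  multiplicative q -> exists c, q (asub a (scalar c)) = 0.
Proof.
intros Hq. pose proof (proj1 Hq) as Hs.
destruct (infimum_exists (fun r => exists c, r = q (asub a (scalar c))) 0)
  as [m [Hle Hglb]].
- now exists (q (asub a (scalar C0))), C0.
- intros r [c ->]. now apply seminorm_ge0.
- assert (Happrox : forall e, 0 < e -> exists c, q (asub a (scalar c)) < m + e).
  { intros e He. apply NNPP. intros H. assert (m + e <= m); [|lra].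
    apply Hglb. intros r [c ->]. apply Rnot_lt_le. intros Hc. apply H. now exists c. }
  assert (Hm : 0 <= m) by (apply Hglb; intros r [c ->]; now apply seminorm_ge0).
  destruct Hm as [Hm|Hm].
  + exfalso. assert (0 < / m) by now apply Rinv_0_lt_compat.
    assert (Hscale : forall c, q (asub (asmul (RtoC (/ m)) a)
      (scalar (Cmul (RtoC (/ m)) c))) = / m * q (asub a (scalar c))).
    { intros c. rewrite <- (seminorm_real q) by (assumption || lra). f_equal.
      rewrite !asmul_scalar, scalar_mul. ring. }
    apply (dist_to_scalars_not_1 q (asmul (RtoC (/ m)) a) Hq).
    * intros c. replace c with (Cmul (RtoC (/ m)) (Cmul (RtoC m) c))
        by (apply Cplx_ext; simpl; field; lra).
      rewrite Hscale. apply Rmult_le_reg_l with m; [assumption|].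
      rewrite <- Rmult_assoc, Rinv_r by lra. rewrite Rmult_1_r, Rmult_1_l.
      apply Hle. eauto.
    * intros d Hd. destruct (Happrox (m * d) ltac:(nra)) as [c Hc].
      exists (Cmul (RtoC (/ m)) c). rewrite Hscale.
      apply Rmult_le_reg_l with m; [assumption|].
      rewrite <- Rmult_assoc, Rinv_r by lra. lra.
  + subst m.
    destruct (Cplx_cauchy_limit Cplx
      (fun U => exists e, 0 < e /\ U = fun c => q (asub a (scalar c)) < e)
      (fun c => c)) as [c Hc].
    * intros U V [e [He ->]] [f [Hf ->]].
      exists (fun c => q (asub a (scalar c)) < Rmin e f). split.
      -- exists (Rmin e f). split; [now apply Rmin_pos|reflexivity].
      -- intros c Hc. pose proof (Rmin_l e f). pose proof (Rmin_r e f). lra.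
    * intros U [e [He ->]]. destruct (Happrox e He) as [c Hc]. exists c. lra.
    * intros e He. exists (fun c => q (asub a (scalar c)) < e / 2). split.
      -- exists (e / 2). split; [lra|reflexivity].
      -- intros s t Hs' Ht. rewrite <- (scalar_norm q _ Hq).
         replace (scalar _) with (asub (asub a (scalar t)) (asub a (scalar s)))
           by (rewrite scalar_add, scalar_opp; ring).
         eapply Rle_lt_trans; [now apply seminorm_sub|lra].
    * exists c. apply Rle_antisym; [|now apply seminorm_ge0].
      apply le_epsilon. intros e He.
      destruct (Hc (e / 2) ltac:(lra)) as [U [[f [Hf ->]] HU]].
      destruct (Happrox (Rmin f (e / 2)) ltac:(apply Rmin_pos; lra)) as [d Hd].
      pose proof (Rmin_l f (e / 2)). pose proof (Rmin_r f (e / 2)).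
      specialize (HU d ltac:(lra)). rewrite <- (scalar_norm q _ Hq) in HU.
      replace (asub a (scalar c)) with
        (aadd (asub a (scalar d)) (scalar (Cadd d (Copp c))))
        by (rewrite scalar_add, scalar_opp; ring).
      eapply Rle_trans; [apply (proj1 Hs)|lra].
Qed.

(** The value at [a] is the unique scalar at [q]-distance 0 from [a]; by uniqueness, each identity
    reduces to an element on which [q] vanishes. *)
Lemma multiplicative_char (q : A -> R) :
  multiplicative q -> exists f, is_char f /\ forall x, Cnorm (f x) = q x.
Proof.
intros Hq. pose proof (proj1 Hq) as Hs.
destruct (function_choice A Cplx (fun a c => q (asub a (scalar c)) = 0)) as [f Hf].
{ intros a. now apply multiplicative_scalar_part. }
assert (Huniq : forall a c, q (asub a (scalar c)) <= 0 -> f a = c).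
{ intros a c Hc.
  assert (H : Cadd (f a) (Copp c) = C0).
  { apply Cnorm_eq0, Rle_antisym; [|apply Cnorm_ge0].
    rewrite <- (scalar_norm q _ Hq).
    replace (scalar _) with (asub (asub a (scalar c)) (asub a (scalar (f a))))
      by (rewrite scalar_add, scalar_opp; ring).
    eapply Rle_trans; [now apply seminorm_sub|]. rewrite Hf. lra. }
  transitivity (Cadd (Cadd (f a) (Copp c)) c); [ring|]. rewrite H. ring. }
exists f. split; [split; [|split; [|split]]|].
- intros x y. apply Huniq.
  replace (asub _ _) with (aadd (asub x (scalar (f x))) (asub y (scalar (f y))))
    by (rewrite scalar_add; ring).
  eapply Rle_trans; [apply (proj1 Hs)|]. rewrite !Hf. lra.
- intros c x. apply Huniq.
  replace (asub _ _) with (asmul c (asub x (scalar (f x))))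
    by (rewrite !asmul_scalar, scalar_mul; ring).
  rewrite (proj2 Hs), Hf. lra.
- intros x y. apply Huniq.
  replace (asub _ _) with (aadd (amul (asub x (scalar (f x))) y)
    (amul (scalar (f x)) (asub y (scalar (f y)))))
    by (rewrite scalar_mul; ring).
  eapply Rle_trans; [apply (proj1 Hs)|]. rewrite !(proj2 (proj2 Hq)), !Hf. lra.
- exists a1. rewrite (Huniq a1 C1).
  + intros H. apply (f_equal Cre) in H. simpl in H. lra.
  + rewrite scalar_C1. replace (asub _ _) with (@a0 A) by ring.
    rewrite seminorm_zero by assumption. lra.
- intros x. rewrite <- (scalar_norm q _ Hq). apply Rle_antisym.
  + replace (scalar (f x)) with (asub x (asub x (scalar (f x)))) by ring.
    eapply Rle_trans; [now apply seminorm_sub|]. rewrite Hf. lra.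
  + replace x with (aadd (asub x (scalar (f x))) (scalar (f x))) at 1 by ring.
    eapply Rle_trans; [apply (proj1 Hs)|]. rewrite Hf. lra.
Qed.

(** Normalizing to p x = 1 reduces to a dominated multiplicative seminorm. Hence bounds on
    characters become bounds on uniform seminorms. *)
Lemma uniform_norming_char (p : A -> R) (x : A) :
  uniform_seminorm p -> 0 < p x ->
  exists g, is_char g /\ (forall z, Cnorm (g z) <= p z) /\ Cnorm (g x) = p x.
Proof.
intros Hu Hx. pose proof (proj1 Hu) as Hp.
assert (0 < / p x) by now apply Rinv_0_lt_compat.
destruct (uniform_dominates_multiplicative p (asmul (RtoC (/ p x)) x) Hu)
  as [q [Hq [Hqp Hqx]]].
{ rewrite seminorm_real by (assumption || lra). field. lra. }
destruct (multiplicative_char q Hq) as [g [Hg Hgq]].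
exists g. split; [assumption|split].
- intros z. rewrite Hgq. apply Hqp.
- rewrite Hgq. rewrite (seminorm_real q) in Hqx by (apply Hq || lra).
  apply Rmult_eq_reg_l with (/ p x); [|lra]. rewrite Hqx. field. lra.
Qed.

End UniformSeminorms.

(** * Ultrafilters and weak* compactness of equibounded sets of characters *)

Lemma ultrafilter_exists (T : Type) (F : (T -> Prop) -> Prop) :
  F (fun _ => True) ->
  (forall P Q, F P -> F Q -> F (fun t => P t /\ Q t)) ->
  (forall P Q : T -> Prop, (forall t, P t -> Q t) -> F P -> F Q) ->
  ~ F (fun _ => False) ->
  exists G : (T -> Prop) -> Prop,
    (forall P, F P -> G P) /\
    (forall P Q, G P -> G Q -> G (fun t => P t /\ Q t)) /\
    (forall P Q : T -> Prop, (forall t, P t -> Q t) -> G P -> G Q) /\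
    (forall P, G P -> exists t, P t) /\
    (forall P, G P \/ G (fun t => ~ P t)).
Proof.
intros HT HI HS H0.
assert (HF : filter.ProperFilter F).
{ constructor; [exact H0|]. constructor; [exact HT|exact HI|exact HS]. }
destruct (filter.ultraFilterLemma HF) as [G [HG HFG]].
pose proof (@filter.ultra_proper _ _ HG) as HP.
pose proof (@filter.filter_filter _ _ HP) as HGF.
exists G. split; [exact HFG|]. split; [|split; [|split]].
- exact (@filter.filterI _ _ HGF).
- exact (@filter.filterS _ _ HGF).
- intros P HGP. apply NNPP. intros Hn.
  apply (@filter.filter_not_empty _ _ HP).
  apply (@filter.filterS _ _ HGF P); [|assumption].
  intros t Ht. apply Hn. now exists t.
- intros P. exact (filter.in_ultra_setVsetC P HG).
Qed.

(** The limit is the supremum of the [r] with r <= h on a set of [G]; for larger [r] the ultrafilter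
    contains the complementary set. *)
Lemma ultrafilter_real_limit (T : Type) (G : (T -> Prop) -> Prop) (h : T -> R) (M : R) :
  (forall P Q, G P -> G Q -> G (fun t => P t /\ Q t)) ->
  (forall P Q : T -> Prop, (forall t, P t -> Q t) -> G P -> G Q) ->
  (forall P, G P -> exists t, P t) ->
  (forall P, G P \/ G (fun t => ~ P t)) ->
  G (fun t => Rabs (h t) <= M) ->
  exists L, forall eps, eps > 0 -> G (fun t => Rabs (h t - L) < eps).
Proof.
intros HI HS Hne Hultra Hb.
destruct (completeness (fun r => G (fun t => r <= h t))) as [L [HL1 HL2]].
- exists M. intros r Hr. destruct (Hne _ (HI _ _ Hb Hr)) as [t [Ht1 Ht2]].
  pose proof (Rle_abs (h t)). lra.
- exists (- M). apply (HS _ _) with (2 := Hb). intros t Ht.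
  pose proof (Rle_abs (- h t)) as H. rewrite Rabs_Ropp in H. lra.
- exists L. intros eps Heps.
  assert (H1 : G (fun t => L - eps < h t)).
  { apply NNPP. intros Hn. assert (L <= L - eps); [|lra].
    apply HL2. intros r Hr. apply Rnot_lt_le. intros Hlt. apply Hn.
    apply (HS _ _) with (2 := Hr). intros t Ht. lra. }
  assert (H2 : G (fun t => ~ L + eps <= h t)).
  { destruct (Hultra (fun t => L + eps <= h t)) as [H|H]; [|assumption].
    apply HL1 in H. lra. }
  apply (HS _ _) with (2 := HI _ _ H1 H2). intros t [Ht1 Ht2].
  apply Rabs_def1; lra.
Qed.

(** For identities that pass to the limit: any error linear in [e] suffices, and e <= 1 lets
    quadratic terms be absorbed. *)
Lemma Cplx_eq_small (z w : Cplx) (K : R) :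
  (forall e, 0 < e <= 1 -> Cnorm (Cadd z (Copp w)) <= K * e) -> z = w.
Proof.
intros H.
assert (H0 : Cadd z (Copp w) = C0).
{ apply Cnorm_eq0, Rle_antisym; [|apply Cnorm_ge0].
  apply le_epsilon. intros e He.
  assert (0 < Rabs K + 1) by (pose proof (Rabs_pos K); lra).
  set (d := Rmin 1 (e / (Rabs K + 1))).
  assert (0 < d) by (apply Rmin_pos; [lra|now apply Rdiv_lt_0_compat]).
  assert (d <= 1) by apply Rmin_l.
  assert (d * (Rabs K + 1) <= e).
  { apply Rle_trans with (e / (Rabs K + 1) * (Rabs K + 1)); [|right; field; lra].
    apply Rmult_le_compat_r; [lra|apply Rmin_r]. }
  specialize (H d ltac:(lra)). pose proof (Rle_abs K). nra. }
transitivity (Cadd (Cadd z (Copp w)) w); [ring|]. rewrite H0. ring.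
Qed.

Lemma Cmul_approx (u v L M : Cplx) (e : R) :
  0 < e <= 1 -> Cnorm (Cadd u (Copp L)) < e -> Cnorm (Cadd v (Copp M)) < e ->
  Cnorm (Cadd (Cmul u v) (Copp (Cmul L M))) <= (Cnorm L + Cnorm M + 1) * e.
Proof.
intros He Hu Hv.
replace (Cadd (Cmul u v) (Copp (Cmul L M))) with
  (Cadd (Cmul (Cadd u (Copp L)) (Cadd v (Copp M)))
    (Cadd (Cmul L (Cadd v (Copp M))) (Cmul (Cadd u (Copp L)) M))) by ring.
rewrite Cnorm_triangle3, !Cnorm_mul.
pose proof (Cnorm_ge0 L). pose proof (Cnorm_ge0 M).
pose proof (Cnorm_ge0 (Cadd u (Copp L))). pose proof (Cnorm_ge0 (Cadd v (Copp M))).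
assert (Cnorm (Cadd u (Copp L)) * Cnorm (Cadd v (Copp M)) <= e * 1)
  by (apply Rmult_le_compat; lra).
assert (Cnorm L * Cnorm (Cadd v (Copp M)) <= Cnorm L * e)
  by (apply Rmult_le_compat_l; lra).
assert (Cnorm (Cadd u (Copp L)) * Cnorm M <= e * Cnorm M)
  by (apply Rmult_le_compat_r; lra).
lra.
Qed.

Lemma char_one (A : CAlgebra) (f : A -> Cplx) : is_char f -> f a1 = C1.
Proof.
intros [_ [_ [HM [x Hx]]]]. destruct (Cplx_inv_exists _ Hx) as [w Hw].
pose proof (HM a1 x) as H. rewrite mul1 in H.
rewrite <- Hw. rewrite H at 1.
replace (Cmul (Cmul (f a1) (f x)) w) with (Cmul (f a1) (Cmul (f x) w)) by ring.
rewrite Hw. ring.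
Qed.

(** A Banach-Alaoglu argument. Without a finite subcover, some ultrafilter contains the set and the
    complements of all cover members; its pointwise limit exists because [D] absorbs, is again a
    character of the set, and lies in some cover member, a contradiction. *)
Lemma equibounded_chars_compact (A : CAlgebra) (D : A -> Prop) :
  (forall a, exists t, 0 < t /\ D (asmul (RtoC t) a)) ->
  wstar_compact (fun g : A -> Cplx => is_char g /\ forall a, D a -> Cnorm (g a) <= 1).
Proof.
intros Habs. set (K := fun g => _). split; [now intros f [Hf _]|].
intros J O HO Hcov. apply NNPP. intros Hno.
pose (F := fun P : (A -> Cplx) -> Prop => exists l : list J,
  forall g, K g -> (forall j, In j l -> ~ O j g) -> P g).
destruct (ultrafilter_exists _ F) as [G [HFG [HI [HS [Hne Hultra]]]]].
- now exists nil.
- intros P Q [l Hl] [l' Hl']. exists (l ++ l'). intros g Hg Hn. split.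
  + apply Hl; [assumption|]. intros j Hj. apply Hn, in_or_app. now left.
  + apply Hl'; [assumption|]. intros j Hj. apply Hn, in_or_app. now right.
- intros P Q HPQ [l Hl]. exists l. auto.
- intros [l Hl]. apply Hno. exists l. intros f Hf. apply NNPP. intros Hn.
  apply (Hl f Hf). intros j Hj Hj'. apply Hn. now exists j.
- assert (HGK : G K) by (apply HFG; now exists nil).
  destruct (function_choice A Cplx (fun a c => forall eps, eps > 0 ->
    G (fun g => Cnorm (Cadd (g a) (Copp c)) < eps))) as [L HL].
  { intros a. destruct (Habs a) as [t [Ht HD]].
    assert (Hb : forall g, K g -> Cnorm (g a) <= / t).
    { intros g [Hg Hg1]. specialize (Hg1 _ HD).
      rewrite (proj1 (proj2 Hg)), Cnorm_mul, Cnorm_real, Rabs_pos_eq in Hg1 by lra.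
      apply Rmult_le_reg_l with t; [assumption|]. rewrite Rinv_r by lra. assumption. }
    destruct (ultrafilter_real_limit _ G (fun g => Cre (g a)) (/ t)) as [x Hx]; auto.
    { apply HS with (2 := HGK). intros g Hg.
      eapply Rle_trans; [apply Cnorm_re|now apply Hb]. }
    destruct (ultrafilter_real_limit _ G (fun g => Cim (g a)) (/ t)) as [y Hy]; auto.
    { apply HS with (2 := HGK). intros g Hg.
      eapply Rle_trans; [apply Cnorm_im|now apply Hb]. }
    exists (mkC x y). intros eps Heps.
    apply HS with (2 := HI _ _ (Hx (eps / 2) ltac:(lra)) (Hy (eps / 2) ltac:(lra))).
    intros g [H1 H2]. eapply Rle_lt_trans; [apply Cnorm_le_re_im|]. simpl.
    unfold Rminus in *. lra. }
  assert (HLK : K L).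
  { split; [split; [|split; [|split]]|].
    - intros x y. apply (Cplx_eq_small _ _ 3). intros e He.
      destruct (Hne _ (HI _ _ HGK (HI _ _ (HL (aadd x y) e ltac:(lra))
        (HI _ _ (HL x e ltac:(lra)) (HL y e ltac:(lra))))))
        as [g [Hg [H1 [H2 H3]]]].
      rewrite (proj1 (proj1 Hg)), Cnorm_sub_sym in H1.
      replace (Cadd _ _) with (Cadd (Cadd (L (aadd x y)) (Copp (Cadd (g x) (g y))))
        (Cadd (Cadd (g x) (Copp (L x))) (Cadd (g y) (Copp (L y))))) by ring.
      rewrite Cnorm_triangle3. lra.
    - intros c x. apply (Cplx_eq_small _ _ (Cnorm c + 1)). intros e He.
      destruct (Hne _ (HI _ _ HGK (HI _ _ (HL (asmul c x) e ltac:(lra))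
        (HL x e ltac:(lra))))) as [g [Hg [H1 H2]]].
      rewrite (proj1 (proj2 (proj1 Hg))), Cnorm_sub_sym in H1.
      replace (Cadd _ _) with (Cadd (Cadd (L (asmul c x)) (Copp (Cmul c (g x))))
        (Cmul c (Cadd (g x) (Copp (L x))))) by ring.
      rewrite Cnorm_triangle, Cnorm_mul. pose proof (Cnorm_ge0 c). nra.
    - intros x y. apply (Cplx_eq_small _ _ (Cnorm (L x) + Cnorm (L y) + 2)).
      intros e He.
      destruct (Hne _ (HI _ _ HGK (HI _ _ (HL (amul x y) e ltac:(lra))
        (HI _ _ (HL x e ltac:(lra)) (HL y e ltac:(lra))))))
        as [g [Hg [H1 [H2 H3]]]].
      rewrite (proj1 (proj2 (proj2 (proj1 Hg)))), Cnorm_sub_sym in H1.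
      rewrite (Cnorm_sub_triangle (Cmul (g x) (g y))).
      pose proof (Cmul_approx _ _ _ _ e He H2 H3). lra.
    (* The limit stays nonzero because every character takes the value 1 at the unit. *)
    - exists a1. intros H0.
      destruct (Hne _ (HI _ _ HGK (HL a1 1 ltac:(lra)))) as [g [Hg H1]].
      rewrite (char_one _ g (proj1 Hg)), H0 in H1.
      replace (Cadd C1 (Copp C0)) with C1 in H1 by ring.
      rewrite Cnorm_C1 in H1. lra.
    - intros a Ha. apply le_epsilon. intros e He.
      destruct (Hne _ (HI _ _ HGK (HL a e ltac:(lra)))) as [g [Hg H1]].
      pose proof (proj2 Hg a Ha). rewrite Cnorm_sub_sym in H1.
      replace (L a) with (Cadd (Cadd (L a) (Copp (g a))) (g a)) by ring.
      rewrite Cnorm_triangle. lra. }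
  destruct (Hcov L HLK) as [j Hj].
  destruct (HO j L (proj1 HLK) Hj) as [l [eps [Heps Hl]]].
  (* A basic neighbourhood of [L] involves finitely many elements, so it belongs to [G]. *)
  assert (HGl : G (fun g => forall x, In x l -> Cnorm (Cadd (g x) (Copp (L x))) < eps)).
  { clear Hl. induction l as [|x l IH].
    - apply HS with (2 := HGK). now intros g _ x [].
    - apply HS with (2 := HI _ _ (HL x eps Heps) IH).
      intros g [H1 H2] y [<-|Hy]; auto. }
  assert (HGj : G (fun g => ~ O j g)).
  { apply HFG. exists (j :: nil). intros g _ Hn. apply Hn. now left. }
  destruct (Hne _ (HI _ _ HGK (HI _ _ HGl HGj))) as [g [Hg [H1 H2]]].
  apply H2, Hl; [apply Hg|assumption].
Qed.

(** * The closure of the image and its continuous characters *)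

Section Closure.
Context {A B : CAlgebra} (opB : (B -> Prop) -> Prop) (Phi : A -> B).
Context (hB : topological_algebra B opB) (hPhi : alg_hom Phi).
Add Ring A_ring : (CAlgebra_ring A).
Add Ring B_ring : (CAlgebra_ring B).

(** Neighbourhoods that may fail to be open, so that continuity at a point suffices to pull them
    back. *)
Definition nbhd (x : B) (S : B -> Prop) : Prop :=
  exists U, opB U /\ U x /\ forall y, U y -> S y.

Lemma nbhd_self x S : nbhd x S -> S x.
Proof. intros [U [_ [Hx HS]]]. now apply HS. Qed.

Lemma nbhd_and x S T : nbhd x S -> nbhd x T -> nbhd x (fun y => S y /\ T y).
Proof.
intros [U [HU [Hx HS]]] [V [HV [Hx' HT]]].
exists (fun y => U y /\ V y). split; [now apply (proj1 hB)|].
split; [tauto|]. intros y [Hy1 Hy2]. auto.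
Qed.

Lemma nbhd_subset x (S T : B -> Prop) : (forall y, S y -> T y) -> nbhd x S -> nbhd x T.
Proof. intros H [U [HU [Hx HS]]]. exists U. auto. Qed.

Lemma nbhd_add x y S : nbhd (aadd x y) S ->
  exists U V, nbhd x U /\ nbhd y V /\ forall x' y', U x' -> V y' -> S (aadd x' y').
Proof.
intros [W [HW [Hxy HS]]].
destruct (proj1 (proj2 (proj2 hB)) x y W HW Hxy) as [U [V [HU [HV [Hx [Hy H]]]]]].
exists U, V. split; [now exists U|]. split; [now exists V|]. auto.
Qed.

Lemma nbhd_translate b x S : nbhd (aadd b x) S -> nbhd x (fun y => S (aadd b y)).
Proof.
intros H. destruct (nbhd_add b x S H) as [U [V [HU [HV HS]]]].
apply nbhd_subset with V; [|assumption]. intros y Hy.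
apply HS; [now apply nbhd_self|assumption].
Qed.

Lemma nbhd_smul c x S : nbhd (asmul c x) S ->
  exists eps, eps > 0 /\ nbhd x (fun y => forall d,
    Cnorm (Cadd d (Copp c)) < eps -> S (asmul d y)).
Proof.
intros [W [HW [Hx HS]]].
destruct (proj1 (proj2 (proj2 (proj2 hB))) c x W HW Hx) as [eps [U [Heps [HU [Hx' H]]]]].
exists eps. split; [assumption|]. exists U. auto.
Qed.

Lemma nbhd_scale c x S : nbhd (asmul c x) S -> nbhd x (fun y => S (asmul c y)).
Proof.
intros H. destruct (nbhd_smul c x S H) as [eps [Heps HU]].
revert HU. apply nbhd_subset. intros y Hy. apply Hy.
replace (Cadd c (Copp c)) with C0 by ring. rewrite Cnorm_C0. lra.
Qed.

Lemma asmul_zero c : asmul c (@a0 B) = a0.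
Proof. rewrite asmul_scalar. ring. Qed.

(** Continuity of scalar multiplication at the pair (0, x). *)
Lemma nbhd_absorbing S x : nbhd a0 S -> exists t, 0 < t /\ S (asmul (RtoC t) x).
Proof.
intros HS. replace (@a0 B) with (asmul C0 x) in HS
  by (rewrite asmul_scalar, scalar_C0; ring).
destruct (nbhd_smul _ _ _ HS) as [eps [Heps HU]].
exists (eps / 2). split; [lra|]. apply (nbhd_self _ _ HU).
replace (Cadd _ _) with (RtoC (eps / 2)) by ring.
rewrite Cnorm_real, Rabs_pos_eq; lra.
Qed.

Lemma nbhd_balanced S : nbhd a0 S ->
  nbhd a0 (fun y => forall c, Cnorm c <= 1 -> S (asmul c y)).
Proof.
intros HS. rewrite <- (asmul_zero C0) in HS.
destruct (nbhd_smul _ _ _ HS) as [eps [Heps HU]].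
(* Dilating by 2/eps leaves the scalar c eps/2, of modulus below [eps]. *)
rewrite <- (asmul_zero (RtoC (2 / eps))) in HU. apply nbhd_scale in HU.
revert HU. apply nbhd_subset. intros y Hy c Hc.
replace (asmul c y) with
  (asmul (Cmul c (RtoC (eps / 2))) (asmul (RtoC (2 / eps)) y)).
- apply Hy. replace (Cadd _ _) with (Cmul c (RtoC (eps / 2))) by ring.
  rewrite Cnorm_mul, Cnorm_real, Rabs_pos_eq by lra. nra.
- rewrite smulA. f_equal. apply Cplx_ext; simpl; field; lra.
Qed.

(** Continuity of subtraction at (b, b); it turns a bound near 0 into a Cauchy condition near
    [b]. *)
Lemma nbhd_difference b S : nbhd a0 S ->
  exists U, nbhd b U /\ forall x y, U x -> U y -> S (asub x y).
Proof.
intros HS. replace (@a0 B) with (aadd b (aopp b)) in HS by ring.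
destruct (nbhd_add _ _ _ HS) as [U [V [HU [HV H]]]].
assert (Hopp : forall x : B, aopp x = asmul (Copp C1) x).
{ intros x. rewrite asmul_scalar, scalar_opp, scalar_C1. ring. }
rewrite Hopp in HV. apply nbhd_scale in HV.
exists (fun y => U y /\ V (asmul (Copp C1) y)). split; [now apply nbhd_and|].
intros x y [Hx _] [_ Hy]. unfold asub. rewrite Hopp. auto.
Qed.

Lemma Phi_sub x y : Phi (asub x y) = asub (Phi x) (Phi y).
Proof.
destruct hPhi as [Hadd [Hsmul _]].
replace (asub x y) with (aadd x (asmul (Copp C1) y)).
- rewrite Hadd, Hsmul, asmul_scalar, scalar_opp, scalar_C1. ring.
- rewrite asmul_scalar, scalar_opp, scalar_C1. ring.
Qed.

Local Notation Cl := (in_closure_im opB Phi).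

Lemma closure_nbhd b S : Cl b -> nbhd b S -> exists a, S (Phi a).
Proof. intros Hb [U [HU [HUb HS]]]. destruct (Hb U HU HUb) as [a Ha]. eauto. Qed.

Lemma closure_image a : Cl (Phi a).
Proof. intros U _ Ha. now exists a. Qed.

Lemma closure_add x y : Cl x -> Cl y -> Cl (aadd x y).
Proof.
intros Hx Hy W HW Hxy.
destruct (nbhd_add x y W) as [U [V [HU [HV H]]]]; [now exists W|].
destruct (closure_nbhd _ _ Hx HU) as [a Ha]. destruct (closure_nbhd _ _ Hy HV) as [b Hb].
exists (aadd a b). rewrite (proj1 hPhi). auto.
Qed.

Lemma closure_smul c x : Cl x -> Cl (asmul c x).
Proof.
intros Hx W HW Hcx.
assert (HU : nbhd x (fun y => W (asmul c y))) by (apply nbhd_scale; now exists W).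
destruct (closure_nbhd _ _ Hx HU) as [a Ha].
exists (asmul c a). now rewrite (proj1 (proj2 hPhi)).
Qed.

Context (hBmul : jointly_continuous opB (@amul B)).

Lemma nbhd_mul x y S : nbhd (amul x y) S ->
  exists U V, nbhd x U /\ nbhd y V /\ forall x' y', U x' -> V y' -> S (amul x' y').
Proof.
intros [W [HW [Hxy HS]]].
destruct (hBmul x y W HW Hxy) as [U [V [HU [HV [Hx [Hy H]]]]]].
exists U, V. split; [now exists U|]. split; [now exists V|]. auto.
Qed.

Lemma closure_mul x y : Cl x -> Cl y -> Cl (amul x y).
Proof.
intros Hx Hy W HW Hxy.
destruct (nbhd_mul x y W) as [U [V [HU [HV H]]]]; [now exists W|].
destruct (closure_nbhd _ _ Hx HU) as [a Ha]. destruct (closure_nbhd _ _ Hy HV) as [b Hb].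
exists (amul a b). rewrite (proj1 (proj2 (proj2 hPhi))). auto.
Qed.

(** The bound makes [g] Cauchy along the traces on the image of the neighbourhoods of any [b] in the
    closure. The extension is the limit, and the algebraic identities pass to it, the product by
    joint continuity. *)
Lemma char_extends (g : A -> Cplx) (W : B -> Prop) :
  is_char g -> nbhd a0 W -> (forall a, W (Phi a) -> Cnorm (g a) <= 1) ->
  exists f, is_cont_char_C opB Phi f /\ forall a, f (Phi a) = g a.
Proof.
intros [Hadd [Hsmul [Hmul [x0 Hx0]]]] HW Hbound.
destruct hPhi as [PAdd [PSmul [PMul P1]]].
assert (Hcauchy : forall b eps, 0 < eps -> exists S, nbhd b S /\
  forall a a', S (Phi a) -> S (Phi a') -> Cnorm (Cadd (g a) (Copp (g a'))) < eps).
{ intros b eps Heps.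
  rewrite <- (asmul_zero (RtoC (2 / eps))) in HW. apply nbhd_scale in HW.
  destruct (nbhd_difference b _ HW) as [U [HU HUW]].
  exists U. split; [assumption|]. intros a a' Ha Ha'.
  specialize (HUW _ _ Ha Ha'). simpl in HUW.
  rewrite <- Phi_sub, <- PSmul in HUW. apply Hbound in HUW.
  rewrite Hsmul, Cnorm_mul, Cnorm_real, Rabs_pos_eq in HUW
    by (apply Rlt_le, Rdiv_lt_0_compat; lra).
  assert (Hsub : g (asub a a') = Cadd (g a) (Copp (g a'))).
  { assert (Hg : g a = Cadd (g (asub a a')) (g a')).
    { rewrite <- Hadd. f_equal. ring. }
    rewrite Hg. ring. }
  rewrite <- Hsub.
  apply Rmult_le_compat_l with (r := eps / 2) in HUW; [|lra].
  replace (eps / 2 * (2 / eps * Cnorm (g (asub a a')))) with (Cnorm (g (asub a a')))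
    in HUW by (field; lra). lra. }
pose (lim := fun b L => forall eps, 0 < eps -> exists S, nbhd b S /\
  forall a, S (Phi a) -> Cnorm (Cadd (g a) (Copp L)) < eps).
destruct (function_choice B Cplx (fun b L => Cl b -> lim b L)) as [f Hf].
(* Off the closure the value is the arbitrary default [C0]. *)
{ intros b. destruct (classic (Cl b)) as [Hb|Hb]; [|now exists C0].
  destruct (Cplx_cauchy_limit A (fun P => exists S, nbhd b S /\
    forall a, S (Phi a) -> P a) g) as [L HL].
  - intros P Q [S [HS HP]] [T [HT HQ]]. exists (fun a => P a /\ Q a). split; [|tauto].
    exists (fun y => S y /\ T y). split; [now apply nbhd_and|].
    intros a [H1 H2]. auto.
  - intros P [S [HS HP]]. destruct (closure_nbhd _ _ Hb HS) as [a Ha]. eauto.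
  - intros eps Heps. destruct (Hcauchy b eps Heps) as [S [HS HSc]].
    exists (fun a => S (Phi a)). split; [|assumption]. now exists S.
  - exists L. intros _ eps Heps. destruct (HL eps Heps) as [P [[S [HS HP]] HPL]].
    exists S. auto. }
assert (Hfg : forall a, f (Phi a) = g a).
{ intros a. apply (Cplx_eq_small _ _ 2). intros e He.
  destruct (Hf _ (closure_image a) e ltac:(lra)) as [S [HS HSe]].
  specialize (HSe a (nbhd_self _ _ HS)). rewrite Cnorm_sub_sym. lra. }
assert (Hnear : forall b S e, Cl b -> nbhd b S -> 0 < e ->
  exists a, S (Phi a) /\ Cnorm (Cadd (g a) (Copp (f b))) < e).
{ intros b S e Hb HS He. destruct (Hf b Hb e He) as [T [HT HTe]].
  destruct (closure_nbhd _ _ Hb (nbhd_and _ _ _ HS HT)) as [a [H1 H2]]. eauto. }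
exists f. split; [|assumption]. split; [|split; [|split; [|split]]].
- intros x y Hx Hy. apply (Cplx_eq_small _ _ 3). intros e He.
  destruct (Hf _ (closure_add _ _ Hx Hy) e ltac:(lra)) as [S [HS HSe]].
  destruct (nbhd_add _ _ _ HS) as [U [V [HU [HV HUV]]]].
  destruct (Hnear x U e Hx HU ltac:(lra)) as [a [Ha Ha']].
  destruct (Hnear y V e Hy HV ltac:(lra)) as [b [Hb Hb']].
  specialize (HUV _ _ Ha Hb). rewrite <- PAdd in HUV. apply HSe in HUV.
  rewrite Hadd, Cnorm_sub_sym in HUV.
  replace (Cadd _ _) with (Cadd (Cadd (f (aadd x y)) (Copp (Cadd (g a) (g b))))
    (Cadd (Cadd (g a) (Copp (f x))) (Cadd (g b) (Copp (f y))))) by ring.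
  rewrite Cnorm_triangle3. lra.
- intros c x Hx. apply (Cplx_eq_small _ _ (Cnorm c + 1)). intros e He.
  destruct (Hf _ (closure_smul c _ Hx) e ltac:(lra)) as [S [HS HSe]].
  apply nbhd_scale in HS.
  destruct (Hnear x _ e Hx HS ltac:(lra)) as [a [Ha Ha']].
  rewrite <- PSmul in Ha. apply HSe in Ha. rewrite Hsmul, Cnorm_sub_sym in Ha.
  replace (Cadd _ _) with (Cadd (Cadd (f (asmul c x)) (Copp (Cmul c (g a))))
    (Cmul c (Cadd (g a) (Copp (f x))))) by ring.
  rewrite Cnorm_triangle, Cnorm_mul. pose proof (Cnorm_ge0 c). nra.
- intros x y Hx Hy. apply (Cplx_eq_small _ _ (Cnorm (f x) + Cnorm (f y) + 2)).
  intros e He.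
  destruct (Hf _ (closure_mul _ _ Hx Hy) e ltac:(lra)) as [S [HS HSe]].
  destruct (nbhd_mul _ _ _ HS) as [U [V [HU [HV HUV]]]].
  destruct (Hnear x U e Hx HU ltac:(lra)) as [a [Ha Ha']].
  destruct (Hnear y V e Hy HV ltac:(lra)) as [b [Hb Hb']].
  specialize (HUV _ _ Ha Hb). rewrite <- PMul in HUV. apply HSe in HUV.
  rewrite Hmul, Cnorm_sub_sym in HUV.
  rewrite (Cnorm_sub_triangle (Cmul (g a) (g b))).
  pose proof (Cmul_approx _ _ _ _ e He Ha' Hb'). lra.
- exists (Phi x0). split; [apply closure_image|]. now rewrite Hfg.
(* The open [U] is also a neighbourhood of each of its points [y], so an image point in [U] compares
   [f y] with [f x]. *)
- intros x eps Hx Heps. destruct (Hf x Hx (eps / 2) ltac:(lra)) as [S [[U [HU [HUx HUS]]] HSe]].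
  exists U. split; [assumption|]. split; [assumption|]. intros y Hy HUy.
  destruct (Hnear y U (eps / 2) Hy ltac:(exists U; auto) ltac:(lra)) as [a [Ha Ha']].
  specialize (HSe a (HUS _ Ha)). rewrite Cnorm_sub_sym in Ha'.
  eapply Rle_lt_trans; [apply (Cnorm_sub_triangle (g a))|]. lra.
Qed.

Lemma cont_char_pullback f :
  is_cont_char_C opB Phi f -> is_char (fun a => f (Phi a)).
Proof.
intros [Hadd [Hsmul [Hmul [[x [Hx Hfx]] _]]]].
destruct hPhi as [PAdd [PSmul [PMul P1]]].
split; [|split; [|split]].
- intros a b. rewrite PAdd. apply Hadd; apply closure_image.
- intros c a. rewrite PSmul. apply Hsmul, closure_image.
- intros a b. rewrite PMul. apply Hmul; apply closure_image.
(* Vanishing at the unit would force [f] to vanish on the whole closure. *)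
- exists a1. intros H0. apply Hfx. rewrite <- (mul1 B x), Hmul.
  + rewrite <- P1, H0. ring.
  + rewrite <- P1. apply closure_image.
  + assumption.
Qed.

(* If |f b| > 1 then 1 - b / f b is close to 1, hence invertible, yet f kills it. *)
Lemma Q_algebra_chars_equibounded :
  Q_algebra_closure opB Phi ->
  exists V, nbhd a0 V /\ forall f a, is_cont_char_C opB Phi f ->
    V (Phi a) -> Cnorm (f (Phi a)) <= 1.
Proof.
intros [U [HU HQ]].
destruct hPhi as [PAdd [PSmul [PMul P1]]].
assert (H1 : Cl a1) by (rewrite <- P1; apply closure_image).
assert (HU1 : U a1).
{ apply HQ; [assumption|]. exists a1. split; [assumption|apply mul1]. }
assert (HW : nbhd a0 (fun y => U (aadd a1 y))).
{ apply nbhd_translate. replace (aadd a1 a0) with (@a1 B) by ring. now exists U. }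
(* Allowing every [c] in the unit disc covers -1/f(b), whose modulus is below 1 when |f(b)| > 1. *)
exists (fun y => forall c, Cnorm c <= 1 -> U (aadd a1 (asmul c y))).
split; [now apply nbhd_balanced in HW|].
intros f a Hf Ha. apply Rnot_lt_le. intros Hlt.
pose proof (cont_char_pullback f Hf) as Hg.
pose proof (char_one _ _ Hg) as Hg1. simpl in Hg1.
assert (Hne : f (Phi a) <> C0) by (intros H0; rewrite H0, Cnorm_C0 in Hlt; lra).
destruct (Cplx_inv_exists _ Hne) as [w Hw].
assert (Hwn : Cnorm (Copp w) <= 1).
{ rewrite Cnorm_opp. apply (f_equal Cnorm) in Hw.
  rewrite Cnorm_mul, Cnorm_C1 in Hw. pose proof (Cnorm_ge0 w). nra. }
specialize (Ha _ Hwn). rewrite <- P1, <- PSmul, <- PAdd in Ha.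
apply HQ in Ha; [|apply closure_image]. destruct Ha as [y [Hy Hinv]].
assert (Hker : f (Phi (aadd a1 (asmul (Copp w) a))) = C0).
{ rewrite (proj1 Hg), (proj1 (proj2 Hg)), Hg1, <- Hw. ring. }
pose proof (proj1 (proj2 (proj2 Hf)) _ _ (closure_image (aadd a1 (asmul (Copp w) a))) Hy)
  as Hprod.
rewrite Hinv, Hker, <- P1, Hg1 in Hprod.
apply (f_equal Cre) in Hprod. simpl in Hprod. lra.
Qed.

End Closure.

(** * Topologies given by uniform seminorms *)

Section UTAlgebra.
Context {A : CAlgebra} {I : Type} (p : I -> A -> R).
Context (hp : forall i, uniform_seminorm (p i)).
Add Ring A_ring : (CAlgebra_ring A).

(** If every seminorm vanished at [a], then [a] would lie in every neighbourhood of 0, against the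
    Hausdorff property. *)
Lemma seminorms_separating (op : (A -> Prop) -> Prop) (a : A) :
  hausdorff op -> (forall U, op U <-> seminorm_open p U) -> a <> a0 ->
  exists i, 0 < p i a.
Proof.
intros Hh Hop Ha. apply NNPP. intros Hn.
destruct (Hh a a0 Ha) as [U [V [_ [HV [HUa [HV0 Hdisj]]]]]].
apply Hop in HV. destruct (HV a0 HV0) as [l [eps [Heps HVl]]].
apply (Hdisj a). split; [assumption|]. apply HVl. intros i _.
apply Rle_lt_trans with 0; [|assumption].
replace (asub a a0) with a by ring.
apply Rnot_lt_le. intros Hi. apply Hn. now exists i.
Qed.

Lemma unit_ball_open i : seminorm_open p (fun x => p i x < 1).
Proof.
intros x Hx. exists (i :: nil), (1 - p i x). split; [lra|].
intros y Hy. specialize (Hy i (or_introl eq_refl)).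
pose proof (proj1 (proj1 (hp i)) (asub y x) x) as H.
replace (aadd (asub y x) x) with y in H by ring. lra.
Qed.

End UTAlgebra.

(** * The cycle of implications between inverse continuity, the strong radical and lifting of
    characters *)

Theorem theorem3p2
  (A B : CAlgebra) (opA : (A -> Prop) -> Prop) (opB : (B -> Prop) -> Prop)
  (hA : uT_algebra A opA)
  (hAreg : weakly_sigma_star_compact_regular A)
  (hB : locally_convex_algebra B opB)
  (hBmul : jointly_continuous opB (@amul B))
  (Phi : A -> B) (hPhi : alg_hom Phi)
  (hinj : forall x y, Phi x = Phi y -> x = y)
  (hQ : Q_algebra_closure opB Phi) :
  let P1 := forall (a : A) (V : A -> Prop), opA V -> V a ->
              exists U, opB U /\ U (Phi a) /\ forall a', U (Phi a') -> V a' in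
  let P2 := forall a : A, strong_radical opB Phi (Phi a) -> Phi a = a0 in
  let P3 := forall g : A -> Cplx, is_char g ->
              exists f, is_cont_char_C opB Phi f /\ forall a, f (Phi a) = g a in
  (P1 <-> P2) /\ (P2 <-> P3).
Proof.
intros P1 P2 P3.
pose proof (proj1 hB) as hBtop.
destruct hA as [[_ [hhaus _]] [I [p [hp hop]]]].
assert (hPhi0 : Phi a0 = a0).
{ pose proof (Phi_sub Phi hPhi a0 a0) as H. unfold asub in H. rewrite !addN in H.
  exact H. }
assert (Hsep : forall a, Phi a <> a0 -> exists i, 0 < p i a).
{ intros a Ha. apply (seminorms_separating p opA); try assumption.
  intros ->. now apply Ha. }
destruct (Q_algebra_chars_equibounded opB Phi hBtop hPhi hQ) as [V [HV HVf]].
assert (H12 : P1 -> P2).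
{ intros H1 a [_ Hrad]. apply NNPP. intros Ha.
  destruct (Hsep a Ha) as [i Hi].
  destruct (uniform_norming_char (p i) a (hp i) Hi) as [g [Hg [Hgp Hga]]].
  (* Continuity of the inverse at 0 gives a neighbourhood [U] on whose trace [g], being dominated by
     [p i], is bounded by 1. *)
  destruct (H1 a0 (fun x => p i x < 1)) as [U [HU [HU0 HUp]]].
  { apply hop. now apply unit_ball_open. }
  { rewrite seminorm_zero by apply hp. lra. }
  destruct (char_extends opB Phi hBtop hPhi hBmul g U Hg) as [f [Hf Hfg]].
  - rewrite <- hPhi0. exists U. auto.
  - intros x Hx. apply HUp in Hx. specialize (Hgp x). lra.
  - specialize (Hrad f Hf). rewrite Hfg in Hrad. rewrite Hrad, Cnorm_C0 in Hga. lra. }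
assert (H23 : P2 -> P3).
{ intros H2 g Hg.
  pose (K := fun g : A -> Cplx => is_char g /\ forall a, V (Phi a) -> Cnorm (g a) <= 1).
  assert (HK : wstar_compact K).
  { apply (equibounded_chars_compact A (fun a => V (Phi a))). intros a.
    destruct (nbhd_absorbing opB hBtop V (Phi a) HV) as [t Ht].
    exists t. now rewrite (proj1 (proj2 hPhi)). }
  destruct (classic (K g)) as [HKg|HKg].
  - apply (char_extends opB Phi hBtop hPhi hBmul g V Hg HV), HKg.
  (* A character outside [K] makes [K] proper, so some nonzero [x] is killed by [K]. Restrictions of
     characters of the closure belong to [K], so [Phi x] lies in the strong radical. *)
  - exfalso. destruct (hAreg K HK) as [x [Hx HxK]]; [now exists g|].
    apply Hx, hinj. rewrite hPhi0. apply H2. split; [apply closure_image|].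
    intros f Hf. apply (HxK (fun a => f (Phi a))). split.
    + now apply cont_char_pullback with opB.
    + intros a. now apply HVf. }
assert (H31 : P3 -> P1).
{ intros H3 a W HW HWa.
  apply hop in HW. destruct (HW a HWa) as [l [eps [Heps HWl]]].
  (* Dilation and translation produce [U] around [Phi a] such that 2/eps times the difference of a
     point of [U] and [Phi a] lies in [V]. *)
  pose proof HV as HV'. rewrite <- (asmul_zero (RtoC (2 / eps))) in HV'.
  apply (nbhd_scale opB hBtop) in HV'.
  replace (@a0 B) with (aadd (aopp (Phi a)) (Phi a)) in HV'
    by (rewrite addC; apply addN).
  apply (nbhd_translate opB hBtop) in HV'.
  destruct HV' as [U [HU [HUa HUV]]].
  exists U. split; [assumption|]. split; [assumption|]. intros a' Ha'.
  apply HWl. intros i _. apply HUV in Ha'.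
  rewrite addC in Ha'. fold (asub (Phi a') (Phi a)) in Ha'.
  rewrite <- (Phi_sub Phi hPhi), <- (proj1 (proj2 hPhi)) in Ha'.
  destruct (Rle_or_lt (p i (asub a' a)) 0) as [H0|H0]; [lra|].
  (* A norming character of a' - a lifts to the closure and is therefore bounded by 1 on the trace
     of [V], so the seminorm of a' - a is at most eps/2. *)
  destruct (uniform_norming_char (p i) _ (hp i) H0) as [g [Hg [_ Hga]]].
  destruct (H3 g Hg) as [f [Hf Hfg]].
  pose proof (HVf f _ Hf Ha') as H1.
  rewrite Hfg, (proj1 (proj2 Hg)), Cnorm_mul, Cnorm_real, Hga, Rabs_pos_eq in H1
    by (apply Rlt_le, Rdiv_lt_0_compat; lra).
  apply Rmult_le_compat_l with (r := eps / 2) in H1; [|lra].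
  replace (eps / 2 * (2 / eps * p i (asub a' a))) with (p i (asub a' a)) in H1
    by (field; lra). lra. }
tauto.
Qed.
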